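(* Assume that one of the hypotheses (Sub), (Sup-1), (Sup-0), (Crit-1), (Crit-2), (Crit-3) described in the context holds. Then for any $K\in\mathbb N$, under the sequence of measures $\mathbb P_N$, $$\frac1N\sum_{j>K}jC_j\longrightarrow 1-\sum_{j=1}^K\kappa_j r_*^j\quad\text{in probability as }N\to\infty.$$
   Context: Model: for $N\in\mathbb N$, $S_N$ is the symmetric group on $\{1,\dots,N\}$; for $\sigma\in S_N$, $C_j=C_j(\sigma)$ is the number of cycles of length $j$ in $\sigma$. Given sequences of nonnegative reals $(\theta_j)_{j\ge1}$, $(\kappa_j)_{j\ge1}$, the probability measure $\mathbb P_N$ on $S_N$ is $\mathbb P_N(\sigma)=\frac{1}{N!H_N}\prod_{j=1}^N(\theta_j+N\kappa_j)^{C_j}$ with $H_N=\frac1{N!}\sum_{\sigma\in S_N}\prod_{j=1}^N(\theta_j+N\kappa_j)^{C_j}$. Generating functions: $g_\theta(z)=\sum_{j\ge1}\theta_jz^j/j$, $g_\kappa(z)=\sum_{j\ge1}\kappa_jz^j/j$. For a function $g$, $g^{\{n\}}(z):=z^n g^{(n)}(z)$. $R\in(0,\infty]$ is the radius of convergence of $g_\kappa$, and $g_\kappa^{\{n\}}(R):=\lim_{r\uparrow R}g_\kappa^{\{n\}}(r)\in[0,\infty]$. Standing assumption: $(\kappa_j)$ is non-arithmetic (there is no integer $j_0>1$ such that $\kappa_j\ne0$ implies that $j_0$ divides $j$) and $\kappa_j>0$ for some $j\ge2$. For $\eta>0$, $\varphi\in(0,\pi/2)$, $\Delta_0=\{z\in\mathbb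 C:|z|<R|1+\eta e^{i\varphi}|,\ z\ne R,\ |\arg(z-R)|>\varphi\}$; ''holomorphic in some $\Delta_0$'' means for some such $\eta,\varphi$. Logarithms and non-integer powers of $1-z/R$ use principal branches. Hypotheses: (Sub) $g_\theta,g_\kappa$ both have radius of convergence $R>0$ and $1<g_\kappa^{\{1\}}(R)\le\infty$. (Sup-1) $g_\theta,g_\kappa$ both have radius of convergence $R>0$, are holomorphic in some $\Delta_0$, $g_\kappa^{\{1\}}(R)<1$, and as $z\to R$, $z\in\Delta_0$: $g_\theta(z)=-\theta^*\log(1-z/R)+O((1-z/R)^\delta)$ and $g_\kappa(z)=g_\kappa(R)-g_\kappa^{\{1\}}(R)(1-z/R)+O((1-z/R)^{1+\delta})$, for some $\theta^*>0$, $\delta>0$. (Sup-0) $g_\kappa$ has radius of convergence $R>0$ and is holomorphic in some $\Delta_0$, $g_\kappa^{\{1\}}(R)<1$, there is a non-integer $s>1$ with $g_\kappa^{\{n\}}(R)<\infty$ for all integers $n<s$ and $g_\kappa^{\{n\}}(R)=\infty$ for $n>s$, and as $z\to R$, $z\in\Delta_0$, $g_\kappa(z)=\sum_{0\le n<s}\frac{(-1)^ng_\kappa^{\{n\}}(R)}{n!}(1-z/R)^n+a_s(1-z/R)^s+O((1-z/R)^{s+\delta})$ with $a_s>0$, $\delta>0$; $g_\theta$ is holomorphic in $\Delta_0$ and regular (holomorphic in a neighbourhood of) at $z=R$. (Crit-1) $g_\theta,g_\kappa$ both have radius of convergence $R>0$, $g_\theta(R)<\infty$, $g_\kappa(R)<\infty$,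 $g_\kappa^{\{1\}}(R)=1$, $0<g_\kappa^{\{2\}}(R)<\infty$. (Crit-2) $g_\theta,g_\kappa$ both have radius of convergence $R>0$ and are holomorphic in some $\Delta_0$, $g_\kappa^{\{1\}}(R)=1$, $0<g_\kappa^{\{2\}}(R)<\infty$, and as $z\to R$, $z\in\Delta_0$: $g_\theta(z)=-\theta^*\log(1-z/R)+O((1-z/R)^\delta)$ with $\theta^*\ge0$, $\delta>0$, and $g_\kappa(z)=g_\kappa(R)-(1-z/R)+\frac12 g_\kappa^{\{2\}}(R)(1-z/R)^2+O((1-z/R)^{2+\delta})$. (Crit-3) as (Crit-2) but without the condition on $g_\kappa^{\{2\}}(R)$ and with the expansion of $g_\kappa$ replaced by $g_\kappa(z)=g_\kappa(R)-(1-z/R)+a_s(1-z/R)^s+O((1-z/R)^{s+\delta})$ with $s\in(1,2)$, $a_s>0$. Definition of $r_*$: if $g_\kappa^{\{1\}}(R)\ge1$, $r_*=r_1$, the unique $r\in(0,R]$ with $g_\kappa^{\{1\}}(r)=1$; if $g_\kappa^{\{1\}}(R)<1$, $r_*=R$. *)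

(* Defs.v *)
From Stdlib Require Import Reals.
From mathcomp Require Import ssreflect ssrfun ssrbool eqtype ssrnat seq
  fintype finset fingroup perm div.
From Coquelicot Require Import Coquelicot.

Set Implicit Arguments.
Unset Strict Implicit.
Unset Printing Implicit Defensive.

Local Open Scope R_scope.

Definition sumR {T : Type} (s : seq T) (f : T -> R) : R :=
  foldr (fun x acc => f x + acc) 0 s.
Definition sumC {T : Type} (s : seq T) (f : T -> C) : C :=
  foldr (fun x acc => (f x + acc)%C) (RtoC 0) s.
Definition prodR {T : Type} (s : seq T) (f : T -> R) : R :=
  foldr (fun x acc => f x * acc) 1 s.

(* C_j(sigma): number of cycles of length j of sigma (fixed points are the
   cycles of length 1); cycles = porbits. *)
Definition cyc (N j : nat) (s : {perm 'I_N}) : nat :=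
  #|[set c in porbits s | #|c| == j]|.

Definition weight (theta kappa : nat -> R) (N : nat) (s : {perm 'I_N}) : R :=
  prodR (seq.iota 1 N) (fun j => (theta j + INR N * kappa j) ^ (cyc j s)).

Definition sum_perm (N : nat) (f : {perm 'I_N} -> R) : R :=
  sumR (enum {perm 'I_N}) f.

Definition H_N (theta kappa : nat -> R) (N : nat) : R :=
  / INR (N`!) * sum_perm (weight theta kappa (N:=N)).

Definition P_N (theta kappa : nat -> R) (N : nat) (s : {perm 'I_N}) : R :=
  weight theta kappa s / (INR (N`!) * H_N theta kappa N).

(* (1/N) sum_{j>K} j C_j(sigma)   (C_j = 0 for j > N) *)
Definition tail_stat (K N : nat) (s : {perm 'I_N}) : R :=
  / INR N * sumR (seq.iota K.+1 (N - K)) (fun j => INR j * INR (cyc j s)).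

Definition prob_dev (theta kappa : nat -> R) (K N : nat) (c eps : R) : R :=
  sum_perm (fun s : {perm 'I_N} =>
    if Rlt_dec eps (Rabs (tail_stat K s - c)) then P_N theta kappa s else 0).

Definition conv_in_prob (theta kappa : nat -> R) (K : nat) (c : R) : Prop :=
  forall eps : R, 0 < eps -> is_lim_seq (fun N => prob_dev theta kappa K N c eps) 0.

Definition gcoef (t : nat -> R) (j : nat) : R :=
  match j with O => 0 | S _ => t j / INR j end.

Definition gn (t : nat -> R) (n : nat) (r : R) : R :=
  r ^ n * Derive_n (PSeries (gcoef t)) n r.

Definition Rbar_at_left (x : Rbar) : (R -> Prop) -> Prop :=
  match x with
  | Finite r => at_left r
  | p_infty => Rbar_locally p_infty
  | m_infty => Rbar_locally m_infty
  end.

Definition gnR (t : nat -> R) (Rad : Rbar) (n : nat) (l : Rbar) : Prop :=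
  filterlim (gn t n) (Rbar_at_left Rad) (Rbar_locally l).

(* principal argument in (-pi, pi] *)
Definition Carg (w : C) : R :=
  let x := fst w in let y := snd w in
  if Rlt_dec 0 x then atan (y / x)
  else if Rlt_dec x 0 then
         (if Rle_dec 0 y then atan (y / x) + PI else atan (y / x) - PI)
  else if Rlt_dec 0 y then PI / 2
  else if Rlt_dec y 0 then - (PI / 2)
  else 0.

Definition Cexp (w : C) : C :=
  (exp (fst w) * cos (snd w), exp (fst w) * sin (snd w)).

Definition Clog (w : C) : C := (ln (Cmod w), Carg w).

Definition Cpow (w : C) (a : R) : C :=
  if Req_EM_T (Cmod w) 0 then RtoC 0 else Cexp (RtoC a * Clog w)%C.

Definition Delta0 (Rr eta phi : R) (z : C) : Prop :=
  Cmod z < Rr * Cmod (RtoC 1 + RtoC eta * Cexp (0, phi))%C /\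
  z <> RtoC Rr /\
  phi < Rabs (Carg (z - RtoC Rr)%C).

Definition holomorphic_on (G : C -> C) (D : C -> Prop) : Prop :=
  forall z, D z -> @ex_derive C_AbsRing C_NormedModule G z.

Definition extends_g (t : nat -> R) (Rr : R) (G : C -> C) : Prop :=
  forall z : C, Cmod z < Rr ->
    @is_pseries C_AbsRing C_NormedModule (fun j => RtoC (gcoef t j)) z (G z).

Definition bigO_at (D : C -> Prop) (Rr : R) (f : C -> C) (h : C -> R) : Prop :=
  exists M rho : R, 0 < rho /\
    forall z, D z -> Cmod (z - RtoC Rr)%C < rho -> Cmod (f z) <= M * h z.

Definition u_of (Rr : R) (z : C) : C := (RtoC 1 - z / RtoC Rr)%C.

(* g "holomorphic in Delta_0": extension G of the series, holomorphic there *)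
Definition holo_ext (t : nat -> R) (Rr eta phi : R) (G : C -> C) : Prop :=
  extends_g t Rr G /\ holomorphic_on G (Delta0 Rr eta phi).

Definition hyp_Sub (theta kappa : nat -> R) : Prop :=
  let Rad := CV_radius (gcoef kappa) in
  CV_radius (gcoef theta) = Rad /\ Rbar_lt 0 Rad /\
  exists l : Rbar, gnR kappa Rad 1 l /\ Rbar_lt 1 l.

Definition hyp_Sup1 (theta kappa : nat -> R) : Prop :=
  exists Rr : R, CV_radius (gcoef kappa) = Finite Rr /\
  CV_radius (gcoef theta) = Finite Rr /\ 0 < Rr /\
  exists (eta phi : R) (Gt Gk : C -> C) (gk0 gk1 thstar delta : R),
    0 < eta /\ 0 < phi < PI / 2 /\
    holo_ext theta Rr eta phi Gt /\ holo_ext kappa Rr eta phi Gk /\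
    gnR kappa (Finite Rr) 0 (Finite gk0) /\
    gnR kappa (Finite Rr) 1 (Finite gk1) /\ gk1 < 1 /\
    0 < thstar /\ 0 < delta /\
    bigO_at (Delta0 Rr eta phi) Rr
      (fun z => Gt z - (- RtoC thstar * Clog (u_of Rr z)))%C
      (fun z : C => Cmod (Cpow (u_of Rr z) delta)) /\
    bigO_at (Delta0 Rr eta phi) Rr
      (fun z => Gk z - (RtoC gk0 - RtoC gk1 * u_of Rr z))%C
      (fun z : C => Cmod (Cpow (u_of Rr z) (1 + delta))).

Definition hyp_Sup0 (theta kappa : nat -> R) : Prop :=
  exists Rr : R, CV_radius (gcoef kappa) = Finite Rr /\ 0 < Rr /\
  exists (eta phi : R) (Gt Gk : C -> C) (eps : R),
    0 < eta /\ 0 < phi < PI / 2 /\ 0 < eps /\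
    holo_ext kappa Rr eta phi Gk /\
    extends_g theta Rr Gt /\
    holomorphic_on Gt (fun z => Delta0 Rr eta phi z \/ Cmod (z - RtoC Rr)%C < eps) /\
    exists (gk1 : R), gnR kappa (Finite Rr) 1 (Finite gk1) /\ gk1 < 1 /\
    exists (s : R) (c : nat -> R) (a_s delta : R),
      1 < s /\ (forall n : nat, INR n <> s) /\
      (forall n : nat, INR n < s -> gnR kappa (Finite Rr) n (Finite (c n))) /\
      (forall n : nat, s < INR n -> gnR kappa (Finite Rr) n p_infty) /\
      0 < a_s /\ 0 < delta /\
      bigO_at (Delta0 Rr eta phi) Rr
        (fun z => Gk z -
           (sumC (seq.iota 0 (Z.to_nat (up s))) (fun n =>
              RtoC ((-1) ^ n * c n / INR (n`!)) * pow_n (u_of Rr z) n)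
            + RtoC a_s * Cpow (u_of Rr z) s))%C
        (fun z : C => Cmod (Cpow (u_of Rr z) (s + delta))).

Definition hyp_Crit1 (theta kappa : nat -> R) : Prop :=
  let Rad := CV_radius (gcoef kappa) in
  CV_radius (gcoef theta) = Rad /\ Rbar_lt 0 Rad /\
  (exists c : R, gnR theta Rad 0 (Finite c)) /\
  (exists c : R, gnR kappa Rad 0 (Finite c)) /\
  gnR kappa Rad 1 (Finite 1) /\
  exists c2 : R, gnR kappa Rad 2 (Finite c2) /\ 0 < c2.

Definition hyp_Crit2 (theta kappa : nat -> R) : Prop :=
  exists Rr : R, CV_radius (gcoef kappa) = Finite Rr /\
  CV_radius (gcoef theta) = Finite Rr /\ 0 < Rr /\
  exists (eta phi : R) (Gt Gk : C -> C) (gk0 gk2 thstar delta : R),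
    0 < eta /\ 0 < phi < PI / 2 /\
    holo_ext theta Rr eta phi Gt /\ holo_ext kappa Rr eta phi Gk /\
    gnR kappa (Finite Rr) 0 (Finite gk0) /\
    gnR kappa (Finite Rr) 1 (Finite 1) /\
    gnR kappa (Finite Rr) 2 (Finite gk2) /\ 0 < gk2 /\
    0 <= thstar /\ 0 < delta /\
    bigO_at (Delta0 Rr eta phi) Rr
      (fun z => Gt z - (- RtoC thstar * Clog (u_of Rr z)))%C
      (fun z : C => Cmod (Cpow (u_of Rr z) delta)) /\
    bigO_at (Delta0 Rr eta phi) Rr
      (fun z => Gk z - (RtoC gk0 - u_of Rr z
                        + RtoC (gk2 / 2) * (u_of Rr z * u_of Rr z)))%C
      (fun z : C => Cmod (Cpow (u_of Rr z) (2 + delta))).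

Definition hyp_Crit3 (theta kappa : nat -> R) : Prop :=
  exists Rr : R, CV_radius (gcoef kappa) = Finite Rr /\
  CV_radius (gcoef theta) = Finite Rr /\ 0 < Rr /\
  exists (eta phi : R) (Gt Gk : C -> C) (gk0 thstar delta s a_s : R),
    0 < eta /\ 0 < phi < PI / 2 /\
    holo_ext theta Rr eta phi Gt /\ holo_ext kappa Rr eta phi Gk /\
    gnR kappa (Finite Rr) 0 (Finite gk0) /\
    gnR kappa (Finite Rr) 1 (Finite 1) /\
    0 <= thstar /\ 0 < delta /\ 1 < s < 2 /\ 0 < a_s /\
    bigO_at (Delta0 Rr eta phi) Rr
      (fun z => Gt z - (- RtoC thstar * Clog (u_of Rr z)))%C
      (fun z : C => Cmod (Cpow (u_of Rr z) delta)) /\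
    bigO_at (Delta0 Rr eta phi) Rr
      (fun z => Gk z - (RtoC gk0 - u_of Rr z + RtoC a_s * Cpow (u_of Rr z) s))%C
      (fun z : C => Cmod (Cpow (u_of Rr z) (s + delta))).

Definition non_arithmetic (kappa : nat -> R) : Prop :=
  ~ (exists j0 : nat, (1 < j0)%N /\
       forall j : nat, (1 <= j)%N -> kappa j <> 0 -> (j0 %| j)%N).

(* r_* : if g_kappa^{1}(R) >= 1, the unique r in (0,R] with g_kappa^{1}(r) = 1
   (at r = R, g^{1}(R) is the left limit); otherwise r_* = R. *)
Definition is_rstar (kappa : nat -> R) (rs : R) : Prop :=
  let Rad := CV_radius (gcoef kappa) in
  exists l : Rbar, gnR kappa Rad 1 l /\
   ((Rbar_le 1 l /\ 0 < rs /\ Rbar_le rs Rad /\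
      (Rbar_lt rs Rad -> gn kappa 1 rs = 1) /\
      (Finite rs = Rad -> l = Finite 1))
    \/ (Rbar_lt l 1 /\ Finite rs = Rad)).

(* Main.v *)
Require Import Defs.
From HB Require Import structures.
From Stdlib Require Import Reals Lra.
From mathcomp Require Import ssreflect ssrfun ssrbool eqtype ssrnat seq
  fintype finset fingroup perm div bigop.
From Coquelicot Require Import Coquelicot.

(** The normalising constant [h_N] is the coefficient of [z^N] in
    [exp (\sum_k (theta_k + N kappa_k) z^k / k)].  Only its exponential order
    matters, so no saddle point or singularity analysis is needed.  For [r < rs]
    close to [rs], [h_N r^N] is at most the generating function at [r].
    Conversely [h_N rs^N >= exp (N (g_kappa(rs) - o(1)))]: take about
    [N kappa_j rs^j / j] cycles of each length [j <= J] and fill up the remaining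
    points with further cycles.  An additional cycle of length [a] costs only a
    factor [kappa_a rs^a].  This is harmless if [\sum_j kappa_j rs^j = 1], as few
    points remain; and if [rs] is the radius of convergence, there are lengths
    [a] with [kappa_a rs^a >= exp (- e a)] for every [e > 0].  Non-arithmeticity
    makes the lengths add up to [N].  Tilting the weights of the cycle lengths
    [j <= K] by [exp (t j)] bounds the exponential moments of
    [\sum_(j <= K) j C_j], and Markov's inequality concludes. *)

Set Implicit Arguments.
Unset Strict Implicit.
Unset Printing Implicit Defensive.

Local Open Scope R_scope.

(** * Real big operators and the coefficients of the exponential of a power series *)

Lemma RplusA : associative Rplus. Proof. by move=> x y z; rewrite Rplus_assoc. Qed.
Lemma RplusC : commutative Rplus. Proof. exact: Rplus_comm. Qed.
Lemma Rplus0 : left_id 0 Rplus. Proof. exact: Rplus_0_l. Qed.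
Lemma RmultA : associative Rmult. Proof. by move=> x y z; rewrite Rmult_assoc. Qed.
Lemma RmultC : commutative Rmult. Proof. exact: Rmult_comm. Qed.
Lemma Rmult1 : left_id 1 Rmult. Proof. exact: Rmult_1_l. Qed.
Lemma Rmult0l : left_zero 0 Rmult. Proof. exact: Rmult_0_l. Qed.
Lemma Rmult0r : right_zero 0 Rmult. Proof. exact: Rmult_0_r. Qed.
Lemma RmultDl : left_distributive Rmult Rplus.
Proof. by move=> x y z; rewrite Rmult_plus_distr_r. Qed.
Lemma RmultDr : right_distributive Rmult Rplus.
Proof. by move=> x y z; rewrite Rmult_plus_distr_l. Qed.

HB.instance Definition _ := Monoid.isComLaw.Build R 0 Rplus RplusA RplusC Rplus0.
HB.instance Definition _ := Monoid.isComLaw.Build R 1 Rmult RmultA RmultC Rmult1.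
HB.instance Definition _ := Monoid.isMulLaw.Build R 0 Rmult Rmult0l Rmult0r.
HB.instance Definition _ := Monoid.isAddLaw.Build R Rmult Rplus RmultDl RmultDr.

Local Notation "\sum_ ( i <- r ) F" := (\big[Rplus/0]_(i <- r) F) : R_scope.
Local Notation "\sum_ ( i : t | P ) F" := (\big[Rplus/0]_(i : t | P) F) : R_scope.
Local Notation "\sum_ ( i 'in' A ) F" := (\big[Rplus/0]_(i in A) F) : R_scope.
Local Notation "\sum_ ( m <= i < n ) F" := (\big[Rplus/0]_(m <= i < n) F) : R_scope.
Local Notation "\sum_ ( m <= i < n | P ) F" := (\big[Rplus/0]_(m <= i < n | P) F) : R_scope.
Local Notation "\prod_ ( i 'in' A ) F" := (\big[Rmult/1]_(i in A) F) : R_scope.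
Local Notation "\prod_ ( i 'in' A | P ) F" := (\big[Rmult/1]_(i in A | P) F) : R_scope.
Local Notation "\prod_ ( m <= i < n ) F" := (\big[Rmult/1]_(m <= i < n) F) : R_scope.

(* [expc_rev w n] lists the coefficients of degree n, n-1, ..., 0 of
   [exp (\sum_(k >= 1) w k z^k / k)]; the recursion is [(exp V)' = V' exp V]. *)
Fixpoint expc_rev (w : nat -> R) (n : nat) : seq R :=
  match n with
  | 0%N => [:: 1]
  | n'.+1 => let s := expc_rev w n' in
      (/ INR n'.+1 * \sum_(0 <= k < n'.+1) w k.+1 * nth 0 s k) :: s
  end.

Definition expc (w : nat -> R) (n : nat) : R := head 0 (expc_rev w n).

Lemma expc0 w : expc w 0 = 1. Proof. by []. Qed.

Lemma nth_expc_rev w n k : (k <= n)%N -> nth 0 (expc_rev w n) k = expc w (n - k).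
Proof.
elim: n k => [|n IH] [|k] //= Hk.
by rewrite IH // subSS.
Qed.

Lemma expcS w n :
  INR n.+1 * expc w n.+1 = \sum_(0 <= k < n.+1) w k.+1 * expc w (n - k).
Proof.
have Hn : INR n.+1 <> 0 by apply: not_0_INR.
rewrite /expc /= -/(expc w) -Rmult_assoc Rinv_r // Rmult_1_l.
apply: eq_big_nat => k /andP[_ Hk]; by rewrite nth_expc_rev // -ltnS.
Qed.

(** * Cycle weights of permutations *)

Lemma iter_Rmult m a : iter m (Rmult a) 1 = a ^ m.
Proof. by elim: m => //= m ->. Qed.

Lemma iter_Rplus m a : iter m (Rplus a) 0 = INR m * a.
Proof. by elim: m => [|m E]; rewrite ?Rmult_0_l // iterS E S_INR; ring. Qed.

Lemma mem_porbit1 (T : finType) (s : {perm T}) x : s x \in porbit s x.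
Proof. by have := mem_porbit s 1 x; rewrite expg1. Qed.

(** Composing with the transposition inserts the fixed point [x] into the cycle of [y], right after
    [y]: the product sends [y] to [x] and [x] to [t y]. *)
Lemma porbit_tpermM_marked (T : finType) (x y : T) (t : {perm T}) :
  t x = x -> y != x ->
  porbit (tperm x y * t)%g x = x |: porbit t y.
Proof.
move=> tx yx; set s := (tperm x y * t)%g.
have sx : s x = t y by rewrite /s permM tpermL.
have sy : s y = x by rewrite /s permM tpermR.
have sz z : z != x -> z != y -> s z = t z.
  by move=> zx zy; rewrite /s permM tpermD // eq_sym.
have tn i : (t ^+ i)%g y != x.
  apply/eqP => E; have := mem_porbit t i y; rewrite E porbit_sym => /porbitP[j].
  have -> : (t ^+ j)%g x = x by elim: j => [|j IH]; rewrite ?expg0 ?perm1 // expgSr permM IH.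
  by move/eqP: yx.
apply/setP => z; rewrite !inE; apply/idP/idP.
  case/porbitP => i ->; elim: i => [|i IH]; first by rewrite expg0 perm1 eqxx.
  rewrite expgSr permM; move: IH; set u := (s ^+ i)%g x.
  case/orP => [/eqP -> | Hu]; first by rewrite sx mem_porbit1 orbT.
  have [->|uy] := eqVneq u y; first by rewrite sy eqxx.
  case/porbitP: Hu uy => j Ej uy.
  by rewrite sz // ?Ej // -permM -expgSr mem_porbit orbT.
case/orP => [/eqP -> | /porbitP[i ->]]; first exact: porbit_id.
have cl v : v \in porbit s x -> s v \in porbit s x.
  by case/porbitP => j ->; rewrite -permM -expgSr mem_porbit.
elim: i => [|i IH].
  by rewrite expg0 perm1 porbit_sym -sy mem_porbit1.
rewrite expgSr permM; move: IH (tn i); set u := (t ^+ i)%g y => Hu ux.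
have [->|uy] := eqVneq u y; first by rewrite -sx cl // porbit_id.
by rewrite -sz // cl.
Qed.

Lemma porbit_tpermM (T : finType) (x y z : T) (t : {perm T}) :
  t x = x -> z != x -> z \notin porbit t y ->
  porbit (tperm x y * t)%g z = porbit t z.
Proof.
move=> tx zx zy; apply/porbit_setP => v.
have E i : ((tperm x y * t) ^+ i)%g z = (t ^+ i)%g z.
  elim: i => [|i IH]; first by rewrite !expg0.
  rewrite !expgSr !permM IH; congr (t _); rewrite tpermD //; apply/eqP => E.
    have := mem_porbit t i z; rewrite -E porbit_sym => /porbitP[j].
    have -> : (t ^+ j)%g x = x.
      by elim: j => [|j IHj]; rewrite ?expg0 ?perm1 // expgSr permM IHj.
    by move/eqP: zx.
  by move/negP: zy; apply; rewrite porbit_sym E mem_porbit.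
by apply/porbitP/porbitP => -[i ->]; exists i; rewrite E.
Qed.

Lemma mem_porbits (T : finType) (s : {perm T}) z : porbit s z \in porbits s.
Proof. exact: imset_f. Qed.

(** Only the cycle of [y] absorbs [x]. The form fits the products in [Zmark], which leave out the
    cycle of the marked point: this is [x] for the product and [y] for [t]. *)
Lemma porbits_tpermM (T : finType) (x y : T) (t : {perm T}) (c : {set T}) :
  t x = x -> y != x ->
  (c \in porbits (tperm x y * t)%g) && (x \notin c)
  = [&& c \in porbits t, y \notin c & x \notin c].
Proof.
move=> tx yx; have [xc|xc] := boolP (x \in c); rewrite ?andbF // !andbT.
apply/idP/andP => [/imsetP[z _ Ec]|[/imsetP[z _ Ec] yc]].
  have zx : z != x by apply: contraNneq xc => <-; rewrite Ec porbit_id.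
  have zy : z \notin porbit t y.
    apply: contra xc => zy; rewrite Ec porbit_sym porbit_tpermM_marked //.
    by rewrite !inE zy orbT.
  rewrite Ec porbit_tpermM //; split; first exact: mem_porbits.
  by rewrite porbit_sym.
have zx : z != x by apply: contraNneq xc => <-; rewrite Ec porbit_id.
have zy : z \notin porbit t y by rewrite porbit_sym -Ec.
by rewrite Ec -(porbit_tpermM tx zx zy) mem_porbits.
Qed.

(* The cycle through the marked point x has its own weight f because deleting x
   from it shortens it by one, turning f into [f \o S]. *)
Definition Zmark (T : finType) (w f : nat -> R) (B : {set T}) (x : T) : R :=
  \sum_(s : {perm T} | perm_on B s)
    (f #|porbit s x| * \prod_(c in porbits s | (c \subset B) && (x \notin c)) w #|c|).

(** Points outside [B] are fixed by [s]; the condition [c \subset B] keeps their one-point cycles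
    out of the product. Points can thus be deleted without changing the type. *)
Definition Zset (T : finType) (w : nat -> R) (B : {set T}) : R :=
  \sum_(s : {perm T} | perm_on B s)
    \prod_(c in porbits s | c \subset B) w #|c|.

Lemma porbit_sub (T : finType) (B : {set T}) (s : {perm T}) x :
  perm_on B s -> x \in B -> porbit s x \subset B.
Proof.
move=> sB xB; apply/subsetP => y /porbitP[i ->].
by elim: i => [|i IH]; rewrite ?expg0 ?perm1 // expgSr permM perm_closed.
Qed.

Lemma Zset_mark (T : finType) w (B : {set T}) x : x \in B -> Zset w B = Zmark w w B x.
Proof.
move=> xB; apply: eq_bigr => s sB.
rewrite (bigD1 (porbit s x)) /=; last by rewrite mem_porbits porbit_sub.
congr (_ * _); apply: eq_bigl => c.
have [/imsetP[z _ ->]|//] := boolP (c \in porbits s).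
by rewrite /= eq_porbit_mem porbit_sym.
Qed.

Lemma Zset0 (T : finType) w : Zset w (set0 : {set T}) = 1.
Proof.
rewrite /Zset (big_pred1 1%g) => [|s]; last first.
  apply/idP/eqP => [s0|->]; last exact: perm_on1.
  by apply: (perm_on_id s0); rewrite cards0.
rewrite big_pred0 // => c; apply/negbTE/negP => /andP[/imsetP[z _ ->]].
by rewrite subset0 => /eqP E; have := porbit_id 1 z; rewrite E inE.
Qed.

(** A permutation of [B] is determined by the preimage [y] of [x] and the permutation [t] of
    [B :\ x] left after cutting [x] out of its cycle. For [y = x] a fixed point is removed;
    otherwise [y] becomes the marked point of a cycle shorter by one. *)
Lemma Zmark_rec (T : finType) w f (B : {set T}) x : x \in B ->
  Zmark w f B x = f 1%N * Zset w (B :\ x) +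
    \sum_(y in B :\ x) Zmark w (f \o S) (B :\ x) y.
Proof.
move=> xB.
have fixx t : perm_on (B :\ x) t -> t x = x.
  by move=> tB; rewrite (out_perm tB) // !inE eqxx.
have -> : Zmark w f B x = \sum_(y in B) \sum_(t : {perm T} | perm_on (B :\ x) t)
    (f #|porbit (tperm x y * t)%g x| *
     \prod_(c in porbits (tperm x y * t)%g | (c \subset B) && (x \notin c)) w #|c|).
  (* Sort by the preimage [y] of [x] and write [s] as [tperm x y * t]; then [y] is the preimage
     exactly when [t] fixes [x]. *)
  rewrite /Zmark (partition_big (fun s : {perm T} => (s^-1)%g x) (mem B)) /=; last first.
    by move=> s sB; rewrite (perm_closed _ (perm_onV sB)).
  apply: eq_bigr => y yB.
  rewrite (reindex_inj (mulgI (tperm x y))) /=; apply: eq_bigl => t.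
  apply/andP/idP => [[sB /eqP E]|tB].
    have Etx : t x = x.
      by have := congr1 (tperm x y * t)%g E; rewrite permKV permM tpermR; apply: esym.
    apply/subsetP => z /[!inE] tz; have zx : z != x.
      by apply: contraNneq tz => ->; rewrite Etx.
    rewrite zx /=.
    have [->//|zy] := eqVneq z y.
    have Ez : (tperm x y * t)%g z = t z by rewrite permM tpermD // eq_sym.
    by apply: (subsetP sB); rewrite inE Ez.
  split.
    apply: perm_onM; last by apply: subset_trans tB _; apply: subD1set.
    apply: subset_trans (tperm_on x y) _; by apply/subsetP => z /[!inE] /orP[] /eqP ->.
  have tVx : (t^-1)%g x = x by apply: (canLR (permK t)); rewrite fixx.
  by rewrite invMg permM tpermV tVx tpermL.
rewrite (bigD1 x) //=; congr (_ + _).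
  rewrite /Zset big_distrr /=; apply: eq_bigr => t tB.
  rewrite tperm1 mul1g; have -> : porbit t x = [set x].
    apply/setP => z; rewrite inE; apply/idP/eqP => [/porbitP[i ->]|->]; last exact: porbit_id.
    by elim: i => [|i IH]; rewrite ?expg0 ?perm1 // expgSr permM IH fixx.
  by rewrite cards1; congr (_ * _); apply: eq_bigl => c; rewrite subsetD1.
rewrite (eq_bigl (mem (B :\ x))); last by move=> y; rewrite !inE andbC.
apply: eq_bigr => y yB'; apply: eq_bigr => t tB.
have yx : y != x by move: yB'; rewrite !inE => /andP[].
rewrite porbit_tpermM_marked ?fixx // cardsU1.
have -> : x \notin porbit t y.
  by apply/negP => /(subsetP (porbit_sub tB yB')); rewrite !inE eqxx.
congr (_ * _); apply: eq_bigl => c.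
have := porbits_tpermM c (fixx _ tB) yx.
rewrite subsetD1; do 2 case: (c \in _); case: (c \subset B); case: (x \in c);
  by case: (y \in c).
Qed.

(** Induction on the size of [B] with [f] arbitrary, since each deletion shifts [f]. All choices of
    [y] contribute equally, and the [Zset] term is again a marked sum, with [f = w], which [expcS]
    evaluates. *)
Lemma Zmark_expc (T : finType) w n : forall f (B : {set T}) x,
  x \in B -> #|B| = n.+1 ->
  Zmark w f B x = INR n`! * \sum_(0 <= k < n.+1) f k.+1 * expc w (n - k).
Proof.
elim: n => [|n IH] f B x xB cB.
  rewrite Zmark_rec //; have -> : B :\ x = set0.
    by apply: cards0_eq; move: (cardsD1 x B); rewrite xB cB => -[].
  by rewrite Zset0 big1 => [|y /[!inE]//]; rewrite big_nat1 /= expc0; ring.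
have cB' : #|B :\ x| = n.+1 by move: (cardsD1 x B); rewrite xB cB => -[].
rewrite Zmark_rec //.
rewrite (eq_bigr (fun _ => INR n`! * \sum_(0 <= k < n.+1) f k.+2 * expc w (n - k))); last first.
  by move=> y yB; rewrite (IH _ _ _ yB cB').
have [y yB] : exists y, y \in B :\ x by apply/set0Pn; rewrite -card_gt0 cB'.
rewrite (Zset_mark _ yB) (IH _ _ _ yB cB') -expcS [X in _ = _ * X]big_nat_recl // subn0.
rewrite big_const cB' iter_Rplus factS mult_INR.
by under [X in _ = _ * (_ + X)]eq_big_nat => k _ do rewrite subSS; ring.
Qed.

Lemma sumR_big (T : Type) (r : seq T) f : sumR r f = \sum_(x <- r) f x.
Proof. by elim: r => [|x r IH]; rewrite ?big_nil // big_cons /= IH. Qed.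

Lemma prodR_big (T : Type) (r : seq T) f : prodR r f = \big[Rmult/1]_(x <- r) f x.
Proof. by elim: r => [|x r IH]; rewrite ?big_nil // big_cons /= IH. Qed.

Lemma sum_permE N (f : {perm 'I_N} -> R) : sum_perm f = \big[Rplus/0]_s f s.
Proof. by rewrite /sum_perm sumR_big big_enum. Qed.

Lemma cyc0 N (s : {perm 'I_N}) : cyc 0 s = 0%N.
Proof.
apply/eqP; rewrite cards_eq0; apply/eqP/setP => c; rewrite !inE.
apply/negbTE/negP => /andP[/imsetP[z _ ->]]; by rewrite (negbTE (card_porbit_neq0 _ _)).
Qed.

(** An arbitrary commutative law is allowed because both the sum of the cycle lengths and the
    product of the cycle weights are needed. *)
Lemma big_porbits (V : Type) (idx : V) (op : Monoid.com_law idx) N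
    (s : {perm 'I_N}) (F : nat -> V) :
  \big[op/idx]_(c in porbits s) F #|c| =
  \big[op/idx]_(1 <= j < N.+1) iter (cyc j s) (op (F j)) idx.
Proof.
rewrite (partition_big (fun c : {set 'I_N} => inord #|c| : 'I_N.+1) xpredT) //=.
have -> : \big[op/idx]_(1 <= j < N.+1) iter (cyc j s) (op (F j)) idx =
    \big[op/idx]_(0 <= j < N.+1) iter (cyc j s) (op (F j)) idx.
  by rewrite [RHS]big_ltn // cyc0 /= Monoid.mul1m.
rewrite big_mkord; apply: eq_bigr => j _.
have E (c : {set 'I_N}) : (inord #|c| == j :> 'I_N.+1) = (#|c| == j :> nat).
  have cN : (#|c| < N.+1)%N by have := max_card (mem c); rewrite [X in (_ <= X)%N]card_ord.
  by rewrite -val_eqE /= inordK.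
rewrite (eq_bigr (fun _ => F j)) => [|c]; last by rewrite E => /andP[_ /eqP ->].
rewrite big_const; congr iter; apply: eq_card => c.
by rewrite !inE /= unfold_in E.
Qed.

Lemma sum_cyc N (s : {perm 'I_N}) :
  \sum_(1 <= j < N.+1) (INR j * INR (cyc j s)) = INR N.
Proof.
under eq_bigr => j _ do rewrite Rmult_comm -iter_Rplus.
rewrite -(big_porbits _ s INR) -(big_morph INR plus_INR (erefl (INR 0))).
congr INR; rewrite -[RHS](card_ord N) -sum1_card.
rewrite (partition_big_imset (porbit s)) /=; apply: eq_bigr => c /imsetP[z _ ->].
by rewrite sum1dep_card; apply: eq_card => x; rewrite inE eq_porbit_mem.
Qed.

Definition short_stat (K N : nat) (s : {perm 'I_N}) : R :=
  \sum_(1 <= j < K.+1) (INR j * INR (cyc j s)).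

(** The cycles cover all [N] points, so the long ones carry what the short ones leave. It then
    suffices to show concentration of [short_stat], a sum over boundedly many lengths. *)
Lemma tail_short K N (s : {perm 'I_N}) : (0 < N)%N -> (K <= N)%N ->
  tail_stat K s = 1 - short_stat K s / INR N.
Proof.
move=> N0 KN; have NR : INR N <> 0 by apply: not_0_INR => E; rewrite E in N0.
rewrite /tail_stat sumR_big.
have := sum_cyc s; rewrite (big_cat_nat (n := K.+1)) //= -/(short_stat K s).
rewrite {1}/index_iota subSS => E.
rewrite (_ : \sum_(j <- _) _ = INR N - short_stat K s); first by field.
by rewrite -E; ring.
Qed.

Definition tilt (K : nat) (t : R) (w : nat -> R) (j : nat) : R :=
  (if (j <= K)%N then exp (t * INR j) else 1) * w j.

Definition weights (theta kappa : nat -> R) (N j : nat) : R :=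
  theta j + INR N * kappa j.

Lemma weightE theta kappa N (s : {perm 'I_N}) :
  weight theta kappa s = \prod_(1 <= j < N.+1) weights theta kappa N j ^ cyc j s.
Proof. by rewrite /weight prodR_big /index_iota subSS subn0. Qed.

Lemma perm_expc N w : (0 < N)%N ->
  \big[Rplus/0]_(s : {perm 'I_N}) \prod_(1 <= j < N.+1) w j ^ cyc j s
  = INR N`! * expc w N.
Proof.
case: N => // n _; have cT : #|[set: 'I_n.+1]| = n.+1 by rewrite cardsT card_ord.
have E := Zmark_expc w w (in_setT (ord0 : 'I_n.+1)) cT.
rewrite -expcS -Zset_mark ?in_setT // in E.
rewrite factS mult_INR; transitivity (INR n`! * (INR n.+1 * expc w n.+1)); last by ring.
rewrite -E /Zset; apply: eq_big => [s|s _].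
  by apply/esym/subsetP => x _; rewrite inE.
under [LHS]eq_bigr => j _ do rewrite -iter_Rmult.
by rewrite -(big_porbits _ s w); apply: eq_bigl => c; rewrite subsetT andbT.
Qed.

Lemma exp_pow_INR x n : exp x ^ n = exp (INR n * x).
Proof. by elim: n => [|n IH]; rewrite ?Rmult_0_l ?exp_0 // S_INR /= IH -exp_plus; congr exp; ring. Qed.

(** The exponential of a sum over cycles is a product over cycles, so an exponential moment is a
    coefficient of the same kind for tilted weights. *)
Lemma perm_mgf theta kappa K N t : (0 < N)%N -> (K <= N)%N ->
  \big[Rplus/0]_(s : {perm 'I_N}) (exp (t * short_stat K s) * weight theta kappa s)
  = INR N`! * expc (tilt K t (weights theta kappa N)) N.
Proof.
move=> N0 KN; rewrite -perm_expc //; apply: eq_bigr => s _.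
rewrite weightE (big_cat_nat (n := K.+1)) //= [RHS](big_cat_nat (n := K.+1)) //=.
rewrite -Rmult_assoc; congr (_ * _); last first.
  apply: eq_big_nat => j /andP[Kj _]; rewrite /tilt leqNgt Kj /=; by rewrite Rmult_1_l.
rewrite /short_stat big_distrr /= (big_morph exp exp_plus exp_0) -big_split /=.
apply: eq_big_nat => j /andP[_ jK]; rewrite /tilt -ltnS jK Rpow_mult_distr exp_pow_INR.
by congr (exp _ * _); ring.
Qed.

(** * Bounds on the coefficients of the exponential *)

Lemma Rsum_le (m n : nat) (F G : nat -> R) :
  (forall i, (m <= i < n)%N -> F i <= G i) ->
  \sum_(m <= i < n) F i <= \sum_(m <= i < n) G i.
Proof.
move=> H; rewrite big_nat_cond [X in _ <= X]big_nat_cond.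
apply: (big_ind2 Rle) => [|x y z t|i /andP[/H]//]; [exact: Rle_refl | exact: Rplus_le_compat].
Qed.

Lemma Rsum_ge0 (m n : nat) (F : nat -> R) :
  (forall i, (m <= i < n)%N -> 0 <= F i) -> 0 <= \sum_(m <= i < n) F i.
Proof.
move=> H; rewrite big_nat_cond.
apply: (big_ind (Rle 0)) => [|x y|i /andP[/H]//]; [exact: Rle_refl | exact: Rplus_le_le_0_compat].
Qed.

Lemma Rsum_widen (m n p : nat) (F : nat -> R) : (m <= n)%N -> (n <= p)%N ->
  (forall i, (n <= i < p)%N -> 0 <= F i) ->
  \sum_(m <= i < n) F i <= \sum_(m <= i < p) F i.
Proof.
move=> mn np H; rewrite [X in _ <= X](big_cat_nat mn np) /=.
have := Rsum_ge0 H; lra.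
Qed.

Lemma INR_S_gt0 n : 0 < INR n.+1. Proof. exact: lt_0_INR (Nat.lt_0_succ n). Qed.

Lemma INR_addn m n : INR (m + n)%N = INR m + INR n. Proof. exact: plus_INR. Qed.
Lemma INR_muln m n : INR (m * n)%N = INR m * INR n. Proof. exact: mult_INR. Qed.

Lemma expc_ge0 w n : (forall k, 0 <= w k.+1) -> 0 <= expc w n.
Proof.
move=> w0; elim/ltn_ind: n => -[|n] IH; first by rewrite expc0; lra.
apply: (Rmult_le_reg_l (INR n.+1)); first exact: INR_S_gt0.
rewrite Rmult_0_r expcS; apply: Rsum_ge0 => k /andP[_ kn].
by apply: Rmult_le_pos => //; apply: IH; rewrite ltnS leq_subr.
Qed.

Lemma expc_mono w w' n : (forall k, 0 <= w k.+1) -> (forall k, w k.+1 <= w' k.+1) ->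
  expc w n <= expc w' n.
Proof.
move=> w0 ww'; elim/ltn_ind: n => -[|n] IH; first by rewrite !expc0; lra.
apply: (Rmult_le_reg_l (INR n.+1)); first exact: INR_S_gt0.
rewrite !expcS; apply: Rsum_le => k /andP[_ kn].
apply: Rmult_le_compat => //; first exact: expc_ge0.
by apply: IH; rewrite ltnS leq_subr.
Qed.

Lemma expc_step w n k : (forall k, 0 <= w k.+1) -> (k <= n)%N ->
  w k.+1 * expc w (n - k) <= INR n.+1 * expc w n.+1.
Proof.
move=> w0 kn; have kn' : (k < n.+1)%N by [].
rewrite expcS (big_cat_nat (leq0n k) (leqW kn)) /= (big_ltn kn').
have P m p : 0 <= \sum_(m <= i < p) (w i.+1 * expc w (n - i)).
  by apply: Rsum_ge0 => i _; apply: Rmult_le_pos => //; exact: expc_ge0.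
have := P 0%N k; have := P k.+1 n.+1; lra.
Qed.

(** The left side is one term of the Cauchy product of the two exponential series. Induction on the
    total degree gets this from the recursion alone. *)
Lemma expc_superadd w w' n m : (forall k, 0 <= w k.+1) -> (forall k, 0 <= w' k.+1) ->
  expc w n * expc w' m <= expc (fun k => w k + w' k) (n + m).
Proof.
move=> w0 w'0; set v := fun k => _.
have v0 k : 0 <= v k.+1 by have := w0 k; have := w'0 k; rewrite /v; lra.
have pw := fun i => expc_ge0 i w0; have pw' := fun i => expc_ge0 i w'0.
have [s E] : exists s, s = (n + m)%N by eexists.
rewrite -E; elim/ltn_ind: s n m E => -[|s] IH n m E.
  by move/esym/eqP: E; rewrite addn_eq0 => /andP[/eqP -> /eqP ->]; rewrite !expc0; lra.
(* The factor [n + m] is split: the recursion for the first coefficient handles the part with [n],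
   that for the second the part with [m]. *)
have half (u u' : nat -> R) i j : (forall k, 0 <= u k.+1) -> (forall k, 0 <= expc u' k) ->
    (i + j = s.+1)%N ->
    (forall i', (i' < i)%N -> expc u i' * expc u' j <= expc v (i' + j)) ->
    INR i * (expc u i * expc u' j) <= \sum_(0 <= k < s.+1) (u k.+1 * expc v (s - k)).
  move=> u0 u'0; case: i => [|i] Es Hu.
    rewrite Rmult_0_l; apply: Rsum_ge0 => k _; apply: Rmult_le_pos => //; exact: expc_ge0.
  rewrite -Rmult_assoc expcS big_distrl /=.
  apply: (Rle_trans _ (\sum_(0 <= k < i.+1) (u k.+1 * expc v (s - k)))); last first.
    apply: Rsum_widen => // [|k _]; first by rewrite -Es leq_addr.
    by apply: Rmult_le_pos => //; exact: expc_ge0.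
  apply: Rsum_le => k /andP[_ ki].
  rewrite Rmult_assoc; apply: Rmult_le_compat_l => //.
  have -> : (s - k = i - k + j)%N.
    by move: Es; rewrite addSn => -[<-]; rewrite addnBAC.
  by apply: Hu; rewrite ltnS leq_subr.
have H1 : INR n * (expc w n * expc w' m) <= \sum_(0 <= k < s.+1) (w k.+1 * expc v (s - k)).
  apply: half => // i' Hi; apply: (IH (i' + m)%N) => //; by rewrite E ltn_add2r.
have H2 : INR m * (expc w' m * expc w n) <= \sum_(0 <= k < s.+1) (w' k.+1 * expc v (s - k)).
  apply: half => // [|i' Hi]; first by rewrite addnC.
  by rewrite Rmult_comm addnC; apply: (IH (n + i')%N) => //; rewrite E ltn_add2l.
apply: (Rmult_le_reg_l (INR s.+1)); first exact: INR_S_gt0.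
rewrite expcS (eq_bigr (fun k => w k.+1 * expc v (s - k) + w' k.+1 * expc v (s - k)));
  last by move=> k _; rewrite /v; ring.
have -> : INR s.+1 = INR n + INR m by rewrite E INR_addn.
rewrite big_split /=; lra.
Qed.

(** The contribution of exactly [c] cycles of length [j.+1], added one at a time by [expc_step]; the
    successive divisors build the factorial. *)
Lemma expc_single w j c : (forall k, 0 <= w k.+1) ->
  (w j.+1 / INR j.+1) ^ c / INR c`! <= expc w (j.+1 * c).
Proof.
move=> w0; have pj := INR_S_gt0 j.
elim: c => [|c IH]; first by rewrite muln0 expc0 /=; lra.
have pc := INR_S_gt0 c.
have Ec : (j.+1 * c.+1 = (j.+1 * c + j).+1)%N by rewrite mulnS addSn addnC.
have := expc_step w0 (leq_addl (j.+1 * c) j); rewrite addnK -Ec INR_muln => H.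
apply: (Rmult_le_reg_l (INR j.+1 * INR c.+1)); first exact: Rmult_lt_0_compat.
apply: Rle_trans H; apply: Rle_trans (Rmult_le_compat_l _ _ _ (w0 j) IH).
have pf : 0 < INR c`! by apply: lt_0_INR; apply/ltP; exact: fact_gt0.
rewrite factS INR_muln -tech_pow_Rmult; apply: Req_le; field; repeat split; lra.
Qed.

Lemma is_derive_bigsum (r : seq nat) (f : nat -> R -> R) (df : nat -> R) (x : R) :
  (forall k, is_derive (f k) x (df k)) ->
  is_derive (fun y => \sum_(k <- r) f k y) x (\sum_(k <- r) df k).
Proof.
move=> H; elim: r => [|k r IH].
  rewrite big_nil; apply: (is_derive_ext (fun=> 0)) => [t|]; first by rewrite big_nil.
  exact: (is_derive_const (0 : R) x).
rewrite big_cons; apply: (is_derive_ext (fun y => f k y + \sum_(i <- r) f i y)) => [t|].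
  by rewrite big_cons.
by apply: is_derive_plus.
Qed.

Lemma is_derive_monomial (a : R) n x :
  is_derive (fun y => a * y ^ n) x (a * (INR n * x ^ n.-1)).
Proof. by auto_derive => //; ring. Qed.

(* A' <= V' A on [0, r] for the degree-N truncations A and V of the generating
   function and of its exponent, so that A exp(-V) is nonincreasing there. *)
Lemma expc_upper w N r : (forall k, 0 <= w k.+1) -> 0 <= r ->
  expc w N * r ^ N <= exp (\sum_(0 <= k < N) (w k.+1 / INR k.+1 * r ^ k.+1)).
Proof.
move=> w0 r0; have h0 n := expc_ge0 n w0.
pose A x := \sum_(0 <= n < N.+1) (expc w n * x ^ n).
pose V x := \sum_(0 <= k < N) (w k.+1 / INR k.+1 * x ^ k.+1).
pose dA x := \sum_(0 <= n < N.+1) (expc w n * (INR n * x ^ n.-1)).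
pose dV x := \sum_(0 <= k < N) (w k.+1 / INR k.+1 * (INR k.+1 * x ^ k)).
have DA x : is_derive A x (dA x).
  apply: (is_derive_bigsum _ (f := fun k y => expc w k * y ^ k)
    (df := fun k => expc w k * (INR k * x ^ k.-1))) => k.
  exact: is_derive_monomial.
have DV x : is_derive V x (dV x).
  apply: (is_derive_bigsum _ (f := fun k y => w k.+1 / INR k.+1 * y ^ k.+1)
    (df := fun k => w k.+1 / INR k.+1 * (INR k.+1 * x ^ k))) => k.
  exact: (is_derive_monomial _ k.+1).
have dAV x : 0 <= x -> dA x <= dV x * A x.
  move=> x0; have px n : 0 <= x ^ n by apply: pow_le.
  have -> : dV x = \sum_(0 <= k < N) (w k.+1 * x ^ k).
    by apply: eq_bigr => k _; have := INR_S_gt0 k => ?; field; lra.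
  rewrite /dA big_nat_recl //= !(Rmult_0_l, Rmult_0_r) Rplus_0_l big_distrl /=.
  (* By the recursion, the derivative of [A] is the part of degree below [N] of the Cauchy product
     of [V'] and [A]; the missing terms are nonnegative. *)
  have -> : \sum_(0 <= i < N) (expc w i.+1 * (INR i.+1 * x ^ i)) =
            \sum_(0 <= i < N) \sum_(0 <= k < N | (k <= i)%N)
               (w k.+1 * x ^ k * (expc w (i - k) * x ^ (i - k))).
    apply: eq_big_nat => i /andP[_ iN].
    rewrite -Rmult_assoc [_ * INR _]Rmult_comm expcS big_distrl /=.
    rewrite (big_nat_widen 0 i.+1 N) //; apply: eq_bigr => k; rewrite ltnS => ki.
    have -> : x ^ i = x ^ k * x ^ (i - k).
      by rewrite -pow_add; congr (_ ^ _); exact: esym (subnKC ki).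
    by ring.
  rewrite (exchange_big_dep xpredT) //=; apply: Rsum_le => k /andP[_ kN].
  rewrite -big_distrr /=; apply: Rmult_le_compat_l; first exact: Rmult_le_pos.
  rewrite (eq_bigl (fun i => xpredT i && (k <= i)%N)) // -big_nat_widenl //.
  rewrite -{1}(add0n k) big_addn.
  under eq_bigr => i _ do rewrite addnK.
  apply: Rsum_widen => // [|i _]; last exact: Rmult_le_pos.
  by apply: leq_trans (leq_subr _ _) _.
have mono : A r * exp (- V r) <= A 0 * exp (- V 0).
  have [->|rp] : r = 0 \/ 0 < r by lra.
    exact: Rle_refl.
  pose phi x := A x * exp (- V x).
  pose dphi x := (dA x - dV x * A x) * exp (- V x).
  have Dphi x : is_derive phi x (dphi x).
    rewrite /phi /dphi; auto_derive.
      by split; [exists (dA x) | split; [exists (dV x)|]].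
    rewrite (is_derive_unique _ _ _ (DA x)) (is_derive_unique _ _ _ (DV x)).
    by rewrite /=; ring.
  have [c [[c1 c2]]] : exists c, (0 <= c <= r) /\ phi r - phi 0 = dphi c * (r - 0).
    have [c [E [c1 c2]]] : exists c, phi r - phi 0 = dphi c * (r - 0) /\ 0 < c < r.
      apply: MVT_cor2 => // c _; exact/is_derive_Reals.
    by exists c; split => //; lra.
  have -> : phi r - phi 0 = A r * exp (- V r) - A 0 * exp (- V 0) by [].
  have : dphi c * (r - 0) <= 0.
    have := dAV c c1; have := exp_pos (- V c); rewrite /dphi => pe le.
    have : (dA c - dV c * A c) * exp (- V c) <= 0 by nra.
    nra.
  lra.
have A0 : A 0 = 1.
  rewrite /A big_nat_recl //= big1 => [|i _]; last by ring.
  by rewrite expc0; ring.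
have V0 : V 0 = 0 by rewrite /V big1 // => i _ /=; ring.
rewrite A0 V0 Ropp_0 exp_0 in mono.
have Ar : expc w N * r ^ N <= A r.
  rewrite /A big_nat_recr //=.
  have : 0 <= \sum_(0 <= i < N) (expc w i * r ^ i).
    by apply: Rsum_ge0 => i _; apply: Rmult_le_pos => //; exact: pow_le.
  lra.
rewrite -/(V r); apply: Rle_trans Ar _.
have pe := exp_pos (V r).
have : A r * exp (- V r) * exp (V r) <= 1 * exp (V r).
  by apply: Rmult_le_compat_r; [lra | rewrite -[1]Rmult_1_l].
by rewrite Rmult_assoc -exp_plus Rplus_opp_l exp_0; lra.
Qed.

(** * Lower bound for the normalising constant *)

Lemma exp_le x y : x <= y -> exp x <= exp y.
Proof. by case=> [/exp_increasing|->]; [left | right]. Qed.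

(** This is [(1 + 1/c)^(c+1) >= e] without denominators, obtained from [1 - x <= exp (- x)] at
    [x = 1/(c+1)]. *)
Lemma exp_mul_pow_le c : exp 1 * INR c ^ c.+1 <= INR c.+1 ^ c.+1.
Proof.
have pc := INR_S_gt0 c.
have H : INR c / INR c.+1 <= exp (- / INR c.+1).
  apply: Rle_trans (exp_ineq1_le _); rewrite S_INR in pc *; apply: Req_le; field; lra.
have H0 : 0 <= INR c / INR c.+1 by apply: Rdiv_le_0_compat => //; exact: pos_INR.
have := pow_incr _ _ c.+1 (conj H0 H).
rewrite exp_pow_INR (_ : INR c.+1 * - / INR c.+1 = - (1)); last by field; lra.
rewrite /Rdiv Rpow_mult_distr pow_inv => H1.
have pp : 0 < INR c.+1 ^ c.+1 by exact: pow_lt.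
have pe := exp_pos 1.
have ee : exp 1 * exp (- (1)) = 1 by rewrite -exp_plus Rplus_opp_r exp_0.
have H2 : INR c ^ c.+1 <= exp (- (1)) * INR c.+1 ^ c.+1.
  have := Rmult_le_compat_r _ _ _ (Rlt_le _ _ pp) H1.
  rewrite Rmult_assoc Rinv_l; lra.
have := Rmult_le_compat_l _ _ _ (Rlt_le _ _ pe) H2.
by rewrite -Rmult_assoc ee Rmult_1_l.
Qed.

(** A crude Stirling bound, [c! <= e (c+1) (c/e)^c]. *)
Lemma fact_exp_le c : INR c`! * exp (INR c) <= exp 1 * INR c.+1 * INR c ^ c.
Proof.
have pe := exp_ineq1_le 1.
case: c => [|c]; first by rewrite /= exp_0; lra.
(* The induction closes on this sharper form, which fails for [c = 0]. *)
suff H : INR c.+1`! * exp (INR c.+1) <= exp 1 * INR c.+1 ^ c.+2.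
  apply: Rle_trans H _; rewrite -tech_pow_Rmult Rmult_assoc.
  apply: Rmult_le_compat_l; first lra.
  apply: Rmult_le_compat_r; first by apply: pow_le; exact: pos_INR.
  by rewrite [INR c.+2]S_INR; lra.
elim: c => [|c IH]; first by rewrite /=; lra.
rewrite factS INR_muln [in exp _]S_INR exp_plus.
have -> : INR c.+2 * INR c.+1`! * (exp (INR c.+1) * exp 1) =
  INR c.+2 * exp 1 * (INR c.+1`! * exp (INR c.+1)) by ring.
have p2 := INR_S_gt0 c.+1.
apply: Rle_trans (Rmult_le_compat_l _ _ _ _ IH) _; first by apply: Rmult_le_pos; lra.
have := exp_mul_pow_le c.+1; rewrite -[INR c.+2 ^ c.+3]tech_pow_Rmult => H.
have : INR c.+2 * exp 1 * (exp 1 * INR c.+1 ^ c.+2) <= INR c.+2 * exp 1 * (INR c.+2 ^ c.+2).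
  by apply: Rmult_le_compat_l H; apply: Rmult_le_pos; lra.
lra.
Qed.

(* The term of index floor x in the series of exp x carries almost all of it. *)
Lemma exp_term_lower eps x y c : 0 < eps <= 1 -> INR c <= x < INR c + 1 -> x <= y ->
  eps * exp (- 2) * exp ((1 - eps) * x) <= y ^ c / INR c`!.
Proof.
move=> [e0 e1] [cx xc] xy; have c0 := pos_INR c.
have pf : 0 < INR c`! by apply: lt_0_INR; apply/ltP; exact: fact_gt0.
have pS := INR_S_gt0 c.
have H1 : INR c ^ c <= y ^ c by apply: pow_incr; lra.
have H2 := fact_exp_le c.
(* The loss [eps] in the exponent pays for the factor [c + 1] of the Stirling bound. Of [exp (- 2)],
   one factor pays for rounding [x] down, the other for the constant [exp 1] in that bound. *)
have H3 : eps * INR c.+1 <= exp (eps * INR c).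
  by have := exp_ineq1_le (eps * INR c); rewrite S_INR; nra.
have H4 : exp ((1 - eps) * x) * exp (eps * INR c) * exp (- 2) <= exp (INR c - 1).
  rewrite -!exp_plus; apply: exp_le; nra.
have H5 : exp (INR c - 1) * INR c`! <= INR c.+1 * INR c ^ c.
  have E : exp 1 * exp (INR c - 1) = exp (INR c) by rewrite -exp_plus; congr exp; ring.
  apply: (Rmult_le_reg_l (exp 1)); first exact: exp_pos.
  rewrite -Rmult_assoc E; lra.
apply: (Rmult_le_reg_r (INR c`! * INR c.+1)); first exact: Rmult_lt_0_compat.
have -> : y ^ c / INR c`! * (INR c`! * INR c.+1) = INR c.+1 * y ^ c by field; lra.
have P1 := exp_pos ((1 - eps) * x); have P2 := exp_pos (- 2).
have H6 : eps * exp (-2) * exp ((1 - eps) * x) * INR c.+1 <= exp (INR c - 1).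
  apply: Rle_trans H4.
  have : exp ((1 - eps) * x) * exp (- 2) * (eps * INR c.+1) <=
         exp ((1 - eps) * x) * exp (- 2) * exp (eps * INR c).
    by apply: Rmult_le_compat_l H3; apply: Rmult_le_pos; lra.
  lra.
have := Rmult_le_compat_r _ _ _ (Rlt_le _ _ pf) H6.
have := Rmult_le_compat_l _ _ _ (Rlt_le _ _ pS) H1.
lra.
Qed.

(* Take floor (X rho_j / j) cycles of each length j <= J. *)
Lemma expc_bulk rho eps X J w : 0 < eps <= 1 -> 0 <= X ->
  (forall k, 0 <= rho k.+1) -> (forall k, 0 <= w k.+1) ->
  (forall k, (k < J)%N -> X * rho k.+1 <= w k.+1) ->
  exists n, [/\ INR n <= X * \sum_(0 <= k < J) rho k.+1,
    X * (\sum_(0 <= k < J) rho k.+1) - INR J * INR J <= INR n &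
    (eps * exp (- 2)) ^ J * exp ((1 - eps) * X * \sum_(0 <= k < J) (rho k.+1 / INR k.+1))
      <= expc w n].
Proof.
move=> e01 X0 rho0; elim: J w => [|J IH] w w0 wX.
  exists 0%N; rewrite !big_nil expc0 /= !Rmult_0_r exp_0; split; lra.
(* Splitting off length [J.+1] lets [expc_superadd] join the old cycles to the new ones. Rounding
   loses at most [j] points at length [j], which stays within [J * J] in total. *)
pose w1 k := if k == J.+1 then 0 else w k.
pose w2 k := if k == J.+1 then w k else 0.
have w10 k : 0 <= w1 k.+1 by rewrite /w1; case: ifP => // _; lra.
have w20 k : 0 <= w2 k.+1 by rewrite /w2; case: ifP => // _; lra.
have [|n [n1 n2 n3]] := IH w1 w10.
  by move=> k kJ; rewrite /w1 eqSS ltn_eqF //; apply: wX; exact: ltnW.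
have pJ := INR_S_gt0 J.
pose x := X * rho J.+1 / INR J.+1.
have x0 : 0 <= x by apply: Rdiv_le_0_compat => //; exact: Rmult_le_pos.
have [c cx] := nfloor_ex x x0.
have Ex : INR J.+1 * x = X * rho J.+1 by rewrite /x; field; lra.
have y1 : x <= w2 J.+1 / INR J.+1.
  rewrite /w2 eqxx /x; apply: Rmult_le_compat_r; last exact: wX.
  by apply/Rlt_le/Rinv_0_lt_compat.
exists (n + J.+1 * c)%N; rewrite !big_nat_recr //= INR_addn INR_muln; split.
- by rewrite Rmult_plus_distr_l -Ex; case: cx => cx _; have := Rmult_le_compat_l _ _ _ (Rlt_le _ _ pJ) cx; lra.
- case: cx => _ /Rlt_le cx; have := Rmult_le_compat_l _ _ _ (Rlt_le _ _ pJ) cx.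
  rewrite Rmult_plus_distr_l Ex; have := pos_INR J.
  by rewrite -/(INR J.+1) S_INR; nra.
- have H1 := expc_single J c w20; have H2 := exp_term_lower e01 cx y1.
  have H3 : expc w1 n * expc w2 (J.+1 * c) <= expc w (n + J.+1 * c).
    apply: Rle_trans (expc_superadd _ _ w10 w20) _.
    apply: expc_mono => k; first by have := w10 k; have := w20 k; lra.
    by rewrite /w1 /w2; case: ifP => _; lra.
  apply: Rle_trans H3.
  have -> : eps * exp (-2) * (eps * exp (-2)) ^ J *
    exp ((1 - eps) * X * (\sum_(0 <= i < J) (rho i.+1 / INR i.+1) + rho J.+1 / INR J.+1)) =
    (eps * exp (-2)) ^ J * exp ((1 - eps) * X * \sum_(0 <= i < J) (rho i.+1 / INR i.+1)) *
    (eps * exp (-2) * exp ((1 - eps) * x)).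
    rewrite (_ : (1 - eps) * X * (_ + _) = (1 - eps) * X *
      \sum_(0 <= i < J) (rho i.+1 / INR i.+1) + (1 - eps) * x); last by rewrite /x; field; lra.
    by rewrite exp_plus; ring.
  have p1 : 0 <= eps * exp (-2) by have := exp_pos (-2); case: e01 => *; nra.
  apply: Rmult_le_compat => //; last exact: Rle_trans H2 H1.
    by apply: Rmult_le_pos; [exact: pow_le | exact: Rlt_le (exp_pos _)].
  by apply: Rmult_le_pos => //; exact: Rlt_le (exp_pos _).
Qed.

(** A numerical semigroup with greatest common divisor 1 contains two consecutive integers [a] and
    [a + 1], and these generate everything from [a * a] on. *)
Lemma semigroup_cofinite (S : nat -> Prop) :
  S 0%N -> (forall a b, S a -> S b -> S (a + b)%N) ->
  (forall d, (1 < d)%N -> exists2 a, S a & ~~ (d %| a)%N) ->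
  exists m0, forall m, (m0 <= m)%N -> S m.
Proof.
move=> S0 SD Sd.
have SM k a : S a -> S (k * a)%N.
  by move=> Sa; elim: k => [|k IH] //; rewrite mulSn; apply: SD.
have [a Sa Sa1] : exists2 a, S a & S a.+1.
  have [d [d0 [a [Sa Sad]]]] : exists d, (0 < d)%N /\ exists a, S a /\ S (a + d)%N.
    have [a Sa a2] := Sd 2%N isT; exists a; split; last by exists 0%N.
    by case: a a2 {Sa}.
  (* Euclidean descent on the gap [d]: if [b = q d + r] with [0 < r < d], then [q (a + d)] and
     [q a + b] lie in [S] at distance [r]. *)
  elim/ltn_ind: d d0 a Sa Sad => d IH d0 a Sa Sad.
  have [d1|d1] := leqP d 1.
    by exists a => //; rewrite -addn1; have <- : d = 1%N by apply/eqP; rewrite eqn_leq d1.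
  have [b Sb bd] := Sd d d1.
  apply: (IH (b %% d)%N _ _ (b %/ d * (a + d))%N); rewrite ?ltn_mod // ?lt0n //.
  - by apply: SM.
  - rewrite mulnDr -addnA -divn_eq; exact: SD (SM _ _ Sa) Sb.
case: (posnP a) => [a0|a0].
  by exists 0%N => m _; rewrite a0 in Sa1; rewrite -[m]muln1; apply: SM.
exists (a * a)%N => m ma.
have H : (m %% a <= m %/ a)%N.
  apply: (@leq_trans a); first by rewrite ltnW // ltn_mod.
  by rewrite leq_divRL.
(* With [m = q a + r] and [r <= q], use [q - r] copies of [a] and [r] copies of [a + 1]. *)
have -> : m = ((m %/ a - m %% a) * a + (m %% a) * a.+1)%N.
  by rewrite mulnS addnCA -mulnDl subnK // addnC -divn_eq.
by apply: SD; apply: SM.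
Qed.

Definition scaled (rho : nat -> R) (N k : nat) : R := INR N * rho k.

Lemma scaled_ge0 rho N : (forall k, 0 <= rho k.+1) -> forall k, 0 <= scaled rho N k.+1.
Proof. by move=> rho0 k; apply: Rmult_le_pos => //; exact: pos_INR. Qed.

(* One more cycle of length a costs only a factor rho_a: the weight N rho_a
   beats the 1/(n + a) of the recursion. *)
Lemma expc_add_cycle rho N n a : (forall k, 0 <= rho k.+1) -> (0 < a)%N -> (n + a <= N)%N ->
  rho a * expc (scaled rho N) n <= expc (scaled rho N) (n + a).
Proof.
case: a => // k rho0 _ nN; have w0 := scaled_ge0 N rho0.
have := expc_step w0 (leq_addl n k); rewrite addnK -addnS /scaled => H.
have pN : 0 < INR (n + k.+1) by rewrite addnS; exact: INR_S_gt0.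
have LN : INR (n + k.+1) <= INR N by apply: le_INR; apply/leP.
have P := expc_ge0 n w0; rewrite /scaled in P.
apply: (Rmult_le_reg_l (INR (n + k.+1))) => //; apply: Rle_trans H.
by rewrite -Rmult_assoc; apply: Rmult_le_compat_r => //; apply: Rmult_le_compat_r.
Qed.

(** Cycles of length [L] fill the points at cost [exp (- lam)] per point, until fewer than [m0 + L]
    are left. These few cost a constant that depends on neither [N] nor [n]. *)
Lemma expc_fill rho L lam :
  (forall k, 0 <= rho k.+1) -> (0 < L)%N -> 0 <= lam -> exp (- lam * INR L) <= rho L ->
  (forall d, (1 < d)%N -> exists a, [/\ (0 < a)%N, 0 < rho a & ~~ (d %| a)%N]) ->
  exists C m0, 0 < C /\ forall N n m, (m0 <= m)%N -> (n + m <= N)%N ->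
    C * exp (- lam * INR m) * expc (scaled rho N) n <= expc (scaled rho N) (n + m).
Proof.
move=> rho0 L0 lam0 rhoL supp.
have h0 N n : 0 <= expc (scaled rho N) n by apply: expc_ge0; exact: scaled_ge0.
(* The sizes that can be filled at a cost uniform in [N] and [n]; they form a semigroup. *)
pose S m := exists c, 0 < c /\ forall N n, (n + m <= N)%N ->
  c * expc (scaled rho N) n <= expc (scaled rho N) (n + m).
have [m0 Sm0] : exists m0, forall m, (m0 <= m)%N -> S m.
  apply: semigroup_cofinite.
  - by exists 1; split; [lra | move=> N n _; rewrite addn0; lra].
  - move=> a b [c [c0 Hc]] [d [d0 Hd]]; exists (d * c); split; first exact: Rmult_lt_0_compat.
    move=> N n H; rewrite addnA; apply: Rle_trans (Hd _ _ _); last by rewrite -addnA.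
    rewrite Rmult_assoc; apply: Rmult_le_compat_l; first lra.
    by apply: Hc; apply: leq_trans H; rewrite addnA leq_addr.
  - move=> d d1; have [a [a0 ra da]] := supp d d1; exists a => //.
    by exists (rho a); split => // N n H; exact: expc_add_cycle.
have [C [C0 HC]] : exists C, 0 < C /\ forall m, (m0 <= m < m0 + L)%N -> forall N n, (n + m <= N)%N ->
    C * expc (scaled rho N) n <= expc (scaled rho N) (n + m).
  elim: (L) => [|l [C [C0 HC]]].
    by exists 1; split=> [|m]; [lra | rewrite addn0 leqNgt; case: ltnP].
  have [c [c0 Hc]] := Sm0 (m0 + l)%N (leq_addr _ _).
  exists (Rmin C c); split; first exact: Rmin_pos.
  move=> m; rewrite addnS ltnS [(m <= _)%N]leq_eqVlt => /andP[m0m /orP[/eqP E|ml]] N n H.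
    apply: Rle_trans (Rmult_le_compat_r _ _ _ (h0 _ _) (Rmin_r _ _)) _.
    by rewrite E; apply: Hc; rewrite -E.
  apply: Rle_trans (Rmult_le_compat_r _ _ _ (h0 _ _) (Rmin_l _ _)) _.
  by apply: HC => //; rewrite m0m.
exists C, m0; split=> // N n m; elim/ltn_ind: m => m IH m0m nm.
have [mL|mL] := ltnP m (m0 + L).
  apply: Rle_trans (HC m _ _ _ nm); last by rewrite m0m.
  apply: Rmult_le_compat_r => //; rewrite -[X in _ <= X]Rmult_1_r.
  apply: Rmult_le_compat_l; first lra.
  by rewrite -exp_0; apply: exp_le; have := pos_INR m; nra.
have Lm : (L <= m)%N by apply: leq_trans mL; rewrite leq_addl.
have Em : (n + m = n + (m - L) + L)%N by rewrite -addnA subnK.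
rewrite Em; apply: Rle_trans (expc_add_cycle rho0 L0 _); last by rewrite -Em.
have H : C * exp (- lam * INR (m - L)) * expc (scaled rho N) n <= expc (scaled rho N) (n + (m - L)).
  apply: IH; first by rewrite ltn_subrL L0 (leq_trans L0).
    by rewrite leq_subRL // addnC.
  by apply: (leq_trans _ nm); rewrite leq_add2l leq_subr.
have -> : exp (- lam * INR m) = exp (- lam * INR L) * exp (- lam * INR (m - L)).
  by rewrite -exp_plus -Rmult_plus_distr_l -INR_addn subnKC.
have P1 := exp_pos (- lam * INR L).
apply: Rle_trans (Rmult_le_compat _ _ _ _ _ _ rhoL H); try lra.
by apply: Rmult_le_pos => //; apply: Rmult_le_pos; [lra | exact: Rlt_le (exp_pos _)].
Qed.

Lemma Rsum_div_le rho n : (forall k, 0 <= rho k.+1) ->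
  \sum_(0 <= k < n) (rho k.+1 / INR k.+1) <= \sum_(0 <= k < n) rho k.+1.
Proof.
move=> rho0; apply: Rsum_le => k _; have pk := INR_S_gt0 k.
apply/Rle_div_l => //; have : 1 <= INR k.+1 by rewrite S_INR; have := pos_INR k; lra.
by have := rho0 k; nra.
Qed.

Lemma exists_nat_ge x : exists n : nat, forall m, (n <= m)%N -> x <= INR m.
Proof.
have [n [_ Hn]] := nfloor_ex (Rmax 0 x) (Rmax_l _ _).
exists n.+1 => m /leP /le_INR; rewrite S_INR; have := Rmax_r 0 x; lra.
Qed.

(** [expc_bulk] produces the main exponential and [expc_fill] completes the configuration to [N]
    points. The two alternatives are the two reasons why filling is cheap: few points remain, or
    some length has a small cost per point. *)
Lemma expc_lower rho eps J :
  (forall k, 0 <= rho k.+1) ->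
  (forall n, \sum_(0 <= k < n) rho k.+1 <= 1) ->
  (forall d, (1 < d)%N -> exists a, [/\ (0 < a)%N, 0 < rho a & ~~ (d %| a)%N]) ->
  (forall e, 0 < e -> exists n, 1 - e <= \sum_(0 <= k < n) rho k.+1) \/
  (forall e, 0 < e -> exists L, (0 < L)%N /\ exp (- e * INR L) <= rho L) ->
  0 < eps ->
  exists N0, forall N, (N0 <= N)%N ->
    exp (INR N * (\sum_(0 <= k < J) (rho k.+1 / INR k.+1) - eps)) <= expc (scaled rho N) N.
Proof.
move=> rho0 rho1 supp alt e0.
pose s n := \sum_(0 <= k < n) rho k.+1.
pose g n := \sum_(0 <= k < n) (rho k.+1 / INR k.+1).
have smono n m : (n <= m)%N -> s n <= s m by move=> nm; apply: Rsum_widen.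
have gmono n m : (n <= m)%N -> g n <= g m.
  move=> nm; apply: Rsum_widen => // i _; apply: Rdiv_le_0_compat => //; exact: INR_S_gt0.
have g1 n : g n <= 1 by apply: Rle_trans (Rsum_div_le n rho0) (rho1 n).
have g0 n : 0 <= g n.
  by apply: Rsum_ge0 => i _; apply: Rdiv_le_0_compat => //; exact: INR_S_gt0.
(* About [N (1 - s J')] points remain to be filled, at cost [lam] each in the exponent, so this
   product must be small. *)
have [L [lam [J' [L0 lam0 rhoL JJ' Hlam]]]] : exists L lam J', [/\ (0 < L)%N, 0 <= lam,
    exp (- lam * INR L) <= rho L, (J <= J')%N & lam * (1 - s J') <= eps / 4].
  case: alt => alt; last first.
    have [|L [L0 HL]] := alt (eps / 4); first lra.
    exists L, (eps / 4), J; split => //; first lra.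
    have : 0 <= s J by apply: Rsum_ge0.
    nra.
  (* Any length of positive weight will do here, since [J'] is chosen after its rate [lam]. The rate
     may be zero, hence the divisor [lam + 1]. *)
  have [[|a] [a0 ra _]] := supp 2%N isT => //.
  have ra1 : rho a.+1 <= 1.
    apply: Rle_trans (rho1 a.+1); rewrite big_nat_recr //=.
    have : 0 <= \sum_(0 <= i < a) rho i.+1 by apply: Rsum_ge0.
    lra.
  have pa := INR_S_gt0 a.
  pose lam := - ln (rho a.+1) / INR a.+1.
  have lam0 : 0 <= lam.
    apply: Rdiv_le_0_compat => //.
    have : ln (rho a.+1) <= ln 1 by apply: ln_le.
    by rewrite ln_1; lra.
  have [|J0 HJ0] := alt (eps / 4 / (lam + 1)); first by apply: Rdiv_lt_0_compat; lra.
  exists a.+1, lam, (maxn J J0); split; rewrite ?leq_maxl //.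
    rewrite (_ : - lam * _ = ln (rho a.+1)); last by rewrite /lam; field; lra.
    by rewrite exp_ln //; exact: Rle_refl.
  have H1 : s J0 <= s (maxn J J0) by apply: smono; rewrite leq_maxr.
  have H2 : 1 - s (maxn J J0) <= eps / 4 / (lam + 1) by rewrite /s in H1 *; lra.
  apply: Rle_trans (Rmult_le_compat_l _ _ _ lam0 H2) _.
  apply: (Rmult_le_reg_r (lam + 1)); first lra.
  have -> : lam * (eps / 4 / (lam + 1)) * (lam + 1) = lam * (eps / 4) by field; lra.
  nra.
have [C [m0 [C0 fill]]] := expc_fill rho0 L0 lam0 rhoL supp.
pose e' := Rmin 1 (eps / 4).
have e'0 : 0 < e' by apply: Rmin_pos; lra.
have e'1 : e' <= 1 by apply: Rmin_l.
have e'e : e' <= eps / 4 by apply: Rmin_r.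
pose D := (e' * exp (- 2)) ^ J'.
have D0 : 0 < D by apply: pow_lt; apply: Rmult_lt_0_compat => //; exact: exp_pos.
(* [c0] collects the terms independent of [N]. Its size, the filling cost and the loss [e'] each
   take at most [N * eps / 4]. *)
pose c0 := ln C + ln D - lam * (INR m0 + INR J' * INR J') - INR m0.
have [N0 HN0] := exists_nat_ge (- c0 / (eps / 4)).
exists (maxn m0 N0) => N; rewrite geq_max => /andP[m0N /HN0 HN].
have X0 : 0 <= INR N - INR m0 by have := le_INR _ _ (elimT leP m0N); lra.
have w0 := scaled_ge0 N rho0.
(* The bulk uses only [N - m0] points, so that at least [m0] remain, as [expc_fill] requires. *)
have [|n [n1 n2 n3]] := expc_bulk (conj e'0 e'1) X0 rho0 w0 (J := J').
  move=> k _; apply: Rmult_le_compat_r => //; have := pos_INR m0; lra.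
have m0p := pos_INR m0; have s1 := rho1 J'; rewrite -/(s J') in n1 n2 s1.
have s0 : 0 <= s J' by apply: Rsum_ge0.
have nm0 : (n + m0 <= N)%N.
  by apply/leP/INR_le; rewrite INR_addn; nra.
have nN : (n <= N)%N by apply: leq_trans nm0; rewrite leq_addr.
have m0m : (m0 <= N - n)%N by rewrite leq_subRL.
have := fill N n (N - n)%N m0m; rewrite subnKC // => /(_ (leqnn N)) H.
apply: Rle_trans H.
have Em : INR (N - n) = INR N - INR n.
  by rewrite -{2}(subnK nN) INR_addn; ring.
have P : 0 <= C * exp (- lam * INR (N - n)).
  by apply: Rmult_le_pos; [lra | exact: Rlt_le (exp_pos _)].
apply: Rle_trans (Rmult_le_compat_l _ _ _ P n3).
rewrite -[in X in _ <= X](exp_ln C C0) -/D -[in X in _ <= X](exp_ln D D0) -!exp_plus.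
apply: exp_le; rewrite Em -/(g J').
have H1 := gmono _ _ JJ'; have H2 := g1 J'; have H3 := g0 J'; rewrite -/(g J).
have H4 : lam * (INR N - INR n) <= INR N * (eps / 4) + lam * (INR m0 + INR J' * INR J').
  have : INR N - INR n <= INR N * (1 - s J') + (INR m0 + INR J' * INR J') by nra.
  move=> /(Rmult_le_compat_l _ _ _ lam0); have := pos_INR N; nra.
have H5 : INR N * g J' - INR m0 - e' * INR N <= (1 - e') * (INR N - INR m0) * g J'.
  have := pos_INR N => N0'.
  have : e' * (INR N - INR m0) * g J' <= e' * INR N.
    have : (INR N - INR m0) * g J' <= INR N by nra.
    by move=> /(Rmult_le_compat_l _ _ _ (Rlt_le _ _ e'0)); lra.
  nra.
have H6 : - c0 <= INR N * (eps / 4).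
  by apply/(Rle_div_l (- c0) (INR N) (eps / 4)) => //; lra.
have H7 : e' * INR N <= INR N * (eps / 4) by have := pos_INR N; nra.
have H8 : INR N * g J <= INR N * g J' by have := pos_INR N; nra.
have H9 : 0 <= INR N * eps by apply: Rmult_le_pos; [exact: pos_INR | lra].
by rewrite /c0 in H6; lra.
Qed.

(** * Exponential moments and concentration *)

Lemma expc_scale r w n : expc (fun k => r ^ k * w k) n = r ^ n * expc w n.
Proof.
elim/ltn_ind: n => -[|n] IH; first by rewrite !expc0 /=; ring.
apply: (Rmult_eq_reg_l (INR n.+1)); last by have := INR_S_gt0 n; lra.
rewrite -Rmult_assoc [_ * r ^ _]Rmult_comm Rmult_assoc !expcS big_distrr /=.
apply: eq_big_nat => k; rewrite ltnS => /andP[_ kn]; rewrite IH ?ltnS ?leq_subr //.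
have -> : r ^ n = r ^ k * r ^ (n - k).
  by rewrite -pow_add; congr (_ ^ _); exact: esym (subnKC kn).
ring.
Qed.

(** From [exp x <= 1 / (1 - x)] and [(1 + x + 2 x^2) (1 - x) = 1 + x^2 (1 - 2 x) >= 1]. *)
Lemma exp_quadratic_le x : Rabs x <= 1 / 2 -> exp x <= 1 + x + 2 * (x * x).
Proof.
move=> /Rabs_le_between [x1 x2]; have H := exp_ineq1_le (- x).
have E : exp x * exp (- x) = 1 by rewrite -exp_plus Rplus_opp_r exp_0.
have P := exp_pos x.
have : exp x * (1 - x) <= 1 by nra.
have : 0 <= x * x * (1 - 2 * x) by apply: Rmult_le_pos; nra.
move=> ?; have : 1 <= (1 + x + 2 * (x * x)) * (1 - x) by nra.
nra.
Qed.

(** [expc_upper] at a radius [r] slightly below [rs], where the [theta] series is bounded. The tilt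
    at most triples that series; on the [kappa] part, the first order term [t j] cancels the divisor
    [j] and yields [t] times the partial sum of [rho]. *)
Lemma expc_tilt_upper theta kappa rs delta K N t B G :
  (forall k, 0 <= theta k.+1) -> (forall k, 0 <= kappa k.+1) -> 0 < rs -> 0 <= delta ->
  let r := rs * exp (- delta) in
  let rho k := kappa k * rs ^ k in
  \sum_(0 <= k < N) (theta k.+1 / INR k.+1 * r ^ k.+1) <= B ->
  \sum_(0 <= k < N) (rho k.+1 / INR k.+1) <= G ->
  \sum_(0 <= k < K) rho k.+1 <= 1 ->
  Rabs t * INR K.+1 <= 1 / 2 -> (K <= N)%N ->
  expc (tilt K t (weights theta kappa N)) N * r ^ N <=
  exp (3 * B + INR N * (G + t * (\sum_(0 <= k < K) rho k.+1)
         + Rabs t * INR K * delta + 2 * (t * t) * INR K.+1)).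
Proof.
move=> th0 ka0 rs0 d0 r rho HB HG rho1 tK KN.
have r0 : 0 <= r by apply: Rmult_le_pos; [lra | exact: Rlt_le (exp_pos _)].
have rho0 k : 0 <= rho k.+1 by apply: Rmult_le_pos => //; apply: pow_le; lra.
have w0 k : 0 <= tilt K t (weights theta kappa N) k.+1.
  apply: Rmult_le_pos; first by case: ifP => _; [exact: Rlt_le (exp_pos _) | lra].
  have := pos_INR N; have := th0 k; have := ka0 k; rewrite /weights; nra.
apply: Rle_trans (expc_upper N w0 r0) _; apply: exp_le.
pose c := t + Rabs t * INR K * delta + 2 * (t * t) * INR K.+1.
pose extra k := if (k < K)%N then rho k.+1 * c else 0.
have key k : tilt K t (weights theta kappa N) k.+1 / INR k.+1 * r ^ k.+1 <=
   3 * (theta k.+1 / INR k.+1 * r ^ k.+1) + INR N * (rho k.+1 / INR k.+1 + extra k).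
  set j := k.+1; have j0 : 0 < INR j by exact: INR_S_gt0.
  pose q := exp (- (INR j * delta)).
  have Er : r ^ j = rs ^ j * q.
    by rewrite /r Rpow_mult_distr exp_pow_INR /q; congr (_ * exp _); ring.
  have q1 : q <= 1 by rewrite -exp_0; apply: exp_le; have := pos_INR j; nra.
  have q2 : 1 - INR j * delta <= q by have := exp_ineq1_le (- (INR j * delta)); rewrite /q; lra.
  have q0 : 0 < q by exact: exp_pos.
  pose E := if (j <= K)%N then exp (t * INR j) else 1.
  (* [c] is [t] plus two errors: one from replacing [rs] by [r], one from the quadratic term of the
     exponential. *)
  have Eb : E <= 3 /\ E * q / INR j <= / INR j + (if (k < K)%N then c else 0).
    rewrite /E -[(k < K)%N]/(j <= K)%N; case: (leqP j K) => kK; last first.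
      split; first lra.
      rewrite Rmult_1_l Rplus_0_r -[X in _ <= X]Rmult_1_l; apply: Rmult_le_compat_r => //.
      exact/Rlt_le/Rinv_0_lt_compat.
    have jK : INR j <= INR K by apply: le_INR; apply/leP.
    have SK : INR K.+1 = INR K + 1 by rewrite S_INR.
    have at0 := Rabs_pos t.
    have tj : Rabs (t * INR j) <= 1 / 2.
      rewrite Rabs_mult (Rabs_pos_eq (INR j)); last lra.
      by apply: Rle_trans tK; apply: Rmult_le_compat_l => //; lra.
    have H := exp_quadratic_le tj.
    have [tj1 tj2] := proj1 (Rabs_le_between _ _) tj.
    split.
      apply: Rle_trans H _; nra.
    have H1 : exp (t * INR j) * q <= (1 + t * INR j + 2 * (t * INR j * (t * INR j))) * q.
      by apply: Rmult_le_compat_r; lra.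
    apply/Rle_div_l => //; rewrite Rmult_plus_distr_r Rinv_l; last lra.
    have H2 : t * q <= t + Rabs t * (INR K * delta).
      have := Rle_abs t; have := Rle_abs (- t); rewrite Rabs_Ropp => a1 a2.
      have : t * q - t <= Rabs t * (1 - q) by nra.
      have : Rabs t * (1 - q) <= Rabs t * (INR K * delta) by apply: Rmult_le_compat_l => //; nra.
      lra.
    have H3 : t * t * INR j * q <= t * t * INR K.+1.
      have tt : 0 <= t * t by nra.
      rewrite Rmult_assoc; apply: Rmult_le_compat_l => //; nra.
    have H4 : (t * q + 2 * (t * t * INR j * q)) * INR j <= c * INR j.
      by apply: Rmult_le_compat_r; rewrite /c; lra.
    lra.
  case: Eb => E3 Eq.
  have -> : tilt K t (weights theta kappa N) j / INR j * r ^ j =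
     E * (theta j / INR j * r ^ j) + INR N * (rho j * (E * q / INR j)).
    rewrite /tilt -/E /weights Er /rho; field; lra.
  have T0 : 0 <= theta j / INR j * r ^ j.
    by apply: Rmult_le_pos; [apply: Rdiv_le_0_compat => //; exact: th0 | exact: pow_le].
  apply: Rplus_le_compat; first exact: Rmult_le_compat_r.
  apply: Rmult_le_compat_l; first exact: pos_INR.
  have := Rmult_le_compat_l _ _ _ (rho0 k) Eq; rewrite /extra -/j.
  by case: ifP => _; rewrite /Rdiv; lra.
have := Rsum_le (m := 0) (n := N) (fun k _ => key k) => H; apply: Rle_trans H _.
have -> : \sum_(0 <= k < N) (3 * (theta k.+1 / INR k.+1 * r ^ k.+1) +
      INR N * (rho k.+1 / INR k.+1 + extra k)) =
    3 * (\sum_(0 <= k < N) (theta k.+1 / INR k.+1 * r ^ k.+1)) +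
    INR N * (\sum_(0 <= k < N) (rho k.+1 / INR k.+1) + \sum_(0 <= k < N) extra k).
  by rewrite big_split -!big_distrr big_split.
have Ex : \sum_(0 <= k < N) extra k = (\sum_(0 <= k < K) rho k.+1) * c.
  have Z : \sum_(K <= k < N) extra k = 0.
    transitivity (\sum_(K <= k < N) 0); last by rewrite big1.
    apply: eq_big_nat => k /andP[Kk _].
    by rewrite /extra ltnNge Kk.
  rewrite (big_cat_nat (n := K)) //= Z.
  rewrite Rplus_0_r big_distrl /=; apply: eq_big_nat => k /andP[_ kK].
  by rewrite /extra kK.
rewrite Ex; set m := \sum_(0 <= k < K) _ in rho1 *.
have m0 : 0 <= m by apply: Rsum_ge0.
(* The bound [m <= 1] is applied to the nonnegative errors only; [t * m] stays exact, as it locates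
   the limit. *)
have mc : m * c <= t * m + Rabs t * INR K * delta + 2 * (t * t) * INR K.+1.
  have a1 : 0 <= Rabs t * INR K * delta.
    by apply: Rmult_le_pos => //; apply: Rmult_le_pos; [exact: Rabs_pos | exact: pos_INR].
  have a2 : 0 <= 2 * (t * t) * INR K.+1.
    by apply: Rmult_le_pos; [nra | exact: pos_INR].
  rewrite /c; nra.
have := pos_INR N => N0.
have : INR N * (\sum_(0 <= i < N) (rho i.+1 / INR i.+1) + m * c) <=
  INR N * (G + t * m + Rabs t * INR K * delta + 2 * (t * t) * INR K.+1).
  by apply: Rmult_le_compat_l => //; lra.
lra.
Qed.

Lemma prob_dev_ge0 theta kappa K N c eps :
  (forall k, 0 <= theta k.+1) -> (forall k, 0 <= kappa k.+1) ->
  0 <= prob_dev theta kappa K N c eps.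
Proof.
move=> th0 ka0; rewrite /prob_dev sum_permE.
have W0 s : 0 <= @weight theta kappa N s.
  rewrite weightE big_add1; apply: (big_ind (Rle 0)) => [|x y|j _]; first lra.
    exact: Rmult_le_pos.
  apply: pow_le; rewrite /weights; have := pos_INR N; have := th0 j; have := ka0 j; nra.
have SW : 0 <= \big[Rplus/0]_(s : {perm 'I_N}) weight theta kappa s.
  by apply: (big_ind (Rle 0)) => [|x y|s _] //; [lra | exact: Rplus_le_le_0_compat].
have pf : 0 < INR N`! by apply: lt_0_INR; apply/ltP; exact: fact_gt0.
apply: (big_ind (Rle 0)) => [|x y|s _]; [lra | exact: Rplus_le_le_0_compat |].
case: Rlt_dec => ? /=; last exact: Rle_refl.
rewrite /P_N /H_N sum_permE -Rmult_assoc Rinv_r ?Rmult_1_l; last lra.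
(* If the total weight is zero, the convention [/ 0 = 0] makes every [P_N] value zero. *)
have [SW'|<-] := SW; first exact: Rdiv_le_0_compat.
rewrite /Rdiv Rinv_0 Rmult_0_r. exact: Rle_refl.
Qed.

(* Markov's inequality for exp (+- t short_stat). *)
Lemma prob_dev_le theta kappa K N m eps t :
  (forall k, 0 <= theta k.+1) -> (forall k, 0 <= kappa k.+1) ->
  (0 < N)%N -> (K <= N)%N -> 0 < t ->
  0 < expc (weights theta kappa N) N ->
  prob_dev theta kappa K N (1 - m) eps <=
  (exp (- t * (INR N * (m + eps))) * expc (tilt K t (weights theta kappa N)) N +
   exp (t * (INR N * (m - eps))) * expc (tilt K (- t) (weights theta kappa N)) N)
  / expc (weights theta kappa N) N.
Proof.
move=> th0 ka0 N0 KN t0 h0; set h := expc _ _ in h0 *.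
have NR : 0 < INR N by apply: lt_0_INR; apply/ltP.
have pf : 0 < INR N`! by apply: lt_0_INR; apply/ltP; exact: fact_gt0.
have W0 s : 0 <= @weight theta kappa N s.
  rewrite weightE big_add1; apply: (big_ind (Rle 0)) => [|x y|j _]; first lra.
    exact: Rmult_le_pos.
  apply: pow_le; rewrite /weights; have := th0 j; have := ka0 j; nra.
have HN : INR N`! * H_N theta kappa N = INR N`! * h.
  rewrite /H_N sum_permE -Rmult_assoc Rinv_r ?Rmult_1_l; last lra.
  by rewrite /h -perm_expc //; apply: eq_bigr => s _; rewrite weightE.
have Hab a b : (a * expc (tilt K t (weights theta kappa N)) N +
     b * expc (tilt K (- t) (weights theta kappa N)) N) / h =
   \big[Rplus/0]_(s : {perm 'I_N}) ((a * exp (t * short_stat K s) +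
     b * exp (- t * short_stat K s)) * (weight theta kappa s / (INR N`! * h))).
  rewrite (eq_bigr (fun s => a / (INR N`! * h) *
     (exp (t * short_stat K s) * weight theta kappa s) + b / (INR N`! * h) *
     (exp (- t * short_stat K s) * weight theta kappa s))); last first.
    by move=> s _; field; lra.
  rewrite big_split -!big_distrr /= !perm_mgf //; field; lra.
rewrite Hab /prob_dev sum_permE.
apply: (big_ind2 Rle) => [|x y z u|s _]; [exact: Rle_refl | exact: Rplus_le_compat |].
have Q0 : 0 <= weight theta kappa s / (INR N`! * h).
  by apply: Rdiv_le_0_compat => //; apply: Rmult_lt_0_compat.
have p1 := exp_pos (- t * (INR N * (m + eps))); have p2 := exp_pos (t * short_stat K s).
have p3 := exp_pos (t * (INR N * (m - eps))); have p4 := exp_pos (- t * short_stat K s).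
have p12 := Rmult_lt_0_compat _ _ p1 p2; have p34 := Rmult_lt_0_compat _ _ p3 p4.
case: Rlt_dec => [dev|?] /=; last by apply: Rmult_le_pos => //; lra.
rewrite /P_N HN -[X in X <= _]Rmult_1_l; apply: Rmult_le_compat_r => //.
have E x : exp x * exp (- x) = 1 by rewrite -exp_plus Rplus_opp_r exp_0.
set S := short_stat K s in p12 p34 *.
have dev' : eps < Rabs (S / INR N - m).
  move: dev; rewrite tail_short // -/S -Rabs_Ropp.
  by rewrite (_ : - (1 - S / INR N - (1 - m)) = S / INR N - m) //; ring.
have ES : S = INR N * (S / INR N) by field; lra.
rewrite -!exp_plus in p12 p34 *.
(* In each tail one of the two exponentials is at least 1, and the other is positive. *)
have [hi|lo] : m + eps <= S / INR N \/ S / INR N <= m - eps.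
  by move: dev'; rewrite /Rabs; case: Rcase_abs => _; lra.
- have : 0 <= - t * (INR N * (m + eps)) + t * S.
    have := Rmult_le_compat_l _ _ _ (Rlt_le _ _ NR) hi; rewrite -ES; nra.
  by move/exp_le; rewrite exp_0; lra.
- have : 0 <= t * (INR N * (m - eps)) + - t * S.
    have := Rmult_le_compat_l _ _ _ (Rlt_le _ _ NR) lo; rewrite -ES; nra.
  by move/exp_le; rewrite exp_0; lra.
Qed.

(** Upper and lower bounds share the exponent [N G], with [G] the value of the [kappa] series at
    [rs]. What is left of the Markov factor [exp (- t N eps)] after all errors still decays
    geometrically. *)
Lemma conv_in_prob_core theta kappa rs K :
  (forall k, 0 <= theta k.+1) -> (forall k, 0 <= kappa k.+1) -> 0 < rs ->
  (forall r, 0 < r < rs -> exists B, forall n,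
     \sum_(0 <= k < n) (theta k.+1 / INR k.+1 * r ^ k.+1) <= B) ->
  let rho k := kappa k * rs ^ k in
  (forall n, \sum_(0 <= k < n) rho k.+1 <= 1) ->
  (forall d, (1 < d)%N -> exists a, [/\ (0 < a)%N, 0 < rho a & ~~ (d %| a)%N]) ->
  (forall e, 0 < e -> exists n, 1 - e <= \sum_(0 <= k < n) rho k.+1) \/
  (forall e, 0 < e -> exists L, (0 < L)%N /\ exp (- e * INR L) <= rho L) ->
  conv_in_prob theta kappa K (1 - \sum_(0 <= k < K) rho k.+1).
Proof.
move=> th0 ka0 rs0 HB rho rho1 supp alt eps e0.
have rho0 k : 0 <= rho k.+1 by apply: Rmult_le_pos => //; apply: pow_le; lra.
pose g n := \sum_(0 <= k < n) (rho k.+1 / INR k.+1).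
have [G [Gub Glub]] : exists G, (forall n, g n <= G) /\
    forall e, 0 < e -> exists n, G - e <= g n.
  have [||G [ub lub]] := completeness (fun x => exists n, x = g n).
  - exists 1 => x [n ->]; exact: Rle_trans (Rsum_div_le n rho0) (rho1 n).
  - by exists (g 0%N), 0%N.
  exists G; split=> [n|e e1]; first by apply: ub; exists n.
  apply: Classical_Prop.NNPP => H.
  have : G <= G - e by apply: lub => x [n ->]; apply: Rnot_lt_le => L; apply: H; exists n; lra.
  lra.
set m := \sum_(0 <= k < K) rho k.+1.
have SK := INR_S_gt0 K.
(* The first bound keeps the tilt within the range of [exp_quadratic_le]; the second makes the
   quadratic error at most [t * eps / 4]. *)
pose t := Rmin (1 / (2 * INR K.+1)) (eps / (8 * INR K.+1)).
have t0 : 0 < t by apply: Rmin_pos; apply: Rdiv_lt_0_compat; lra.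
have tK1 : t * INR K.+1 <= 1 / 2.
  have := Rmult_le_compat_r _ _ _ (Rlt_le _ _ SK) (Rmin_l (1 / (2 * INR K.+1)) (eps / (8 * INR K.+1))).
  by rewrite -/t => H; apply: Rle_trans H _; apply: Req_le; field; lra.
have tK2 : t * INR K.+1 <= eps / 8.
  have := Rmult_le_compat_r _ _ _ (Rlt_le _ _ SK) (Rmin_r (1 / (2 * INR K.+1)) (eps / (8 * INR K.+1))).
  by rewrite -/t => H; apply: Rle_trans H _; apply: Req_le; field; lra.
have te : 0 < t * eps by apply: Rmult_lt_0_compat.
(* The gain is [t * eps = 8 d]. The quadratic error takes [2 d]; the change of radius in the tilted
   term and in [r ^ N], the truncation at [J] and the loss in [expc_lower] take at most [d] each.
   The remaining [2 d] is the rate [a]. *)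
pose d := t * eps / 8; have d0 : 0 < d by rewrite /d; lra.
pose r := rs * exp (- d).
have r0 : 0 < r by apply: Rmult_lt_0_compat => //; exact: exp_pos.
have rrs : r < rs.
  have : exp (- d) < 1 by rewrite -exp_0; apply: exp_increasing; lra.
  rewrite /r; nra.
have [B HBr] := HB r (conj r0 rrs).
have [J HJ] := Glub d d0.
have [N0 HN0] := expc_lower J rho0 rho1 supp alt d0.
pose a := t * eps / 4.
have bound N : (maxn N0 K.+1 <= N)%N ->
    prob_dev theta kappa K N (1 - m) eps <= 2 * exp (3 * B) * exp (- a) ^ N.
  rewrite geq_max => /andP[N0N KN].
  have Npos : (0 < N)%N by exact: leq_trans KN.
  have {}KN : (K <= N)%N by exact: ltnW.
  set w := weights theta kappa N; set h := expc w N.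
  have pr : 0 < rs ^ N by exact: pow_lt.
  (* Dropping [theta] only decreases the coefficient, and the powers of [rs] come out by
     [expc_scale]. *)
  have hl : exp (INR N * (g J - d)) <= rs ^ N * h.
    apply: Rle_trans (HN0 N N0N) _; rewrite -expc_scale; apply: expc_mono => k.
      exact: scaled_ge0.
    rewrite /scaled /rho /w /weights; have := th0 k; have : 0 < rs ^ k.+1 by exact: pow_lt.
    by move=> p1 p2; have := Rmult_le_pos _ _ (Rlt_le _ _ p1) p2; lra.
  have h0 : 0 < h.
    have := exp_pos (INR N * (g J - d)) => p.
    by apply: (Rmult_lt_reg_l (rs ^ N)) => //; rewrite Rmult_0_r; lra.
  apply: Rle_trans (prob_dev_le m eps th0 ka0 Npos KN t0 h0) _.
  apply/Rle_div_l => //; rewrite -/w -/h.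
  have tilt_le u : Rabs u = t -> exp (- u * (INR N * m) - t * (INR N * eps)) * expc (tilt K u w) N <=
      exp (3 * B) * exp (- a) ^ N * h.
    move=> ut; have tK : Rabs u * INR K.+1 <= 1 / 2 by rewrite ut.
    have := expc_tilt_upper th0 ka0 rs0 (Rlt_le _ _ d0) (HBr N) (Gub N) (rho1 K) tK KN.
    rewrite -/r -/rho -/m -/w => up.
    have prN : 0 < r ^ N by exact: pow_lt.
    have rN : r ^ N = rs ^ N * exp (- (INR N * d)).
      by rewrite /r Rpow_mult_distr exp_pow_INR; congr (_ * exp _); ring.
    apply: (Rmult_le_reg_r (r ^ N)) => //; rewrite Rmult_assoc.
    apply: Rle_trans (Rmult_le_compat_l _ _ _ (Rlt_le _ _ (exp_pos _)) up) _.
    rewrite rN exp_pow_INR.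
    have -> : exp (3 * B) * exp (INR N * - a) * h * (rs ^ N * exp (- (INR N * d))) =
      (exp (3 * B) * exp (INR N * - a) * exp (- (INR N * d))) * (rs ^ N * h) by ring.
    apply: Rle_trans (Rmult_le_compat_l _ _ _ _ hl); last first.
      by rewrite -!exp_plus; exact: Rlt_le (exp_pos _).
    rewrite -!exp_plus; apply: exp_le.
    have uu : u * u = t * t.
      by rewrite -ut; move: (Rsqr_abs u); rewrite /Rsqr.
    rewrite ut uu.
    have K1 : t * INR K * d <= d by rewrite S_INR in tK1; nra.
    have K2 : 2 * (t * t) * INR K.+1 <= t * eps / 4.
      have := Rmult_le_compat_l _ _ _ (Rlt_le _ _ t0) tK2; lra.
    have NR := pos_INR N.
    suff : INR N * (G + t * INR K * d + 2 * (t * t) * INR K.+1 - t * eps) <=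
       INR N * (- a - d + (g J - d)) by lra.
    by apply: Rmult_le_compat_l => //; rewrite /a /d in K1 HJ *; lra.
  have T1 := tilt_le t (Rabs_pos_eq _ (Rlt_le _ _ t0)).
  have T2 := tilt_le (- t); rewrite Rabs_Ropp in T2.
  have {}T2 := T2 (Rabs_pos_eq _ (Rlt_le _ _ t0)).
  rewrite (_ : - t * (INR N * (m + eps)) = - t * (INR N * m) - t * (INR N * eps)); last by ring.
  rewrite (_ : t * (INR N * (m - eps)) = - - t * (INR N * m) - t * (INR N * eps)); last by ring.
  lra.
apply: (is_lim_seq_le_le_loc (fun=> 0) _ (fun N => 2 * exp (3 * B) * exp (- a) ^ N)).
- exists (maxn N0 K.+1) => N /leP HN; split; first exact: prob_dev_ge0.
  exact: bound.
- exact: is_lim_seq_const.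
- have -> : Finite 0 = Rbar_mult (2 * exp (3 * B)) 0 by rewrite /= Rmult_0_r.
  apply: is_lim_seq_scal_l; apply: is_lim_seq_geom.
  rewrite Rabs_pos_eq; last exact: Rlt_le (exp_pos _).
  by rewrite -exp_0; apply: exp_increasing; rewrite /a; lra.
Qed.

(** * Generating functions inside and at the radius of convergence *)

Lemma sum_n_big (a : nat -> R) n : sum_n a n = \sum_(0 <= k < n.+1) a k.
Proof.
elim: n => [|n IH]; first by rewrite sum_O big_nat1.
by rewrite sum_Sn IH [RHS]big_nat_recr.
Qed.

Lemma sum_n_gcoef t r n :
  sum_n (fun k => gcoef t k * r ^ k) n = \sum_(0 <= k < n) (t k.+1 / INR k.+1 * r ^ k.+1).
Proof. by rewrite sum_n_big big_nat_recl //= Rmult_0_l Rplus_0_l. Qed.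

Lemma gcoef_ge0 t n : (forall k, 0 <= t k.+1) -> 0 <= gcoef t n.
Proof.
move=> t0; case: n => [|n]; first exact: Rle_refl.
by apply: Rdiv_le_0_compat => //; exact: INR_S_gt0.
Qed.

Lemma gseries_bounded t r l :
  (forall k, 0 <= t k.+1) -> 0 <= r ->
  is_lim_seq (sum_n (fun k => gcoef t k * r ^ k)) (Finite l) ->
  forall n, \sum_(0 <= k < n) (t k.+1 / INR k.+1 * r ^ k.+1) <= l.
Proof.
move=> t0 r0 H n; rewrite -sum_n_gcoef.
apply: (is_lim_seq_incr_compare _ _ H) => m; rewrite sum_Sn.
have : 0 <= gcoef t m.+1 * r ^ m.+1.
  by apply: Rmult_le_pos; [exact: gcoef_ge0 | exact: pow_le].
rewrite /plus /=; lra.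
Qed.

Lemma gseries_bounded_CV_radius t r :
  (forall k, 0 <= t k.+1) -> 0 <= r -> Rbar_lt r (CV_radius (gcoef t)) ->
  exists B, forall n, \sum_(0 <= k < n) (t k.+1 / INR k.+1 * r ^ k.+1) <= B.
Proof.
move=> t0 r0 rR; have rR' : Rbar_lt (Rabs r) (CV_radius (gcoef t)) by rewrite Rabs_pos_eq.
have [l Hl] := CV_disk_correct _ _ (CV_disk_inside _ _ rR').
by exists l; apply: gseries_bounded => //; move/is_pseries_R: Hl.
Qed.

(** Real parts of the complex series at [z = r]; this serves [hyp_Sup0], which describes the [theta]
    series through its extension. *)
Lemma gseries_bounded_extends t r Rr G :
  (forall k, 0 <= t k.+1) -> 0 <= r < Rr -> extends_g t Rr G ->
  exists B, forall n, \sum_(0 <= k < n) (t k.+1 / INR k.+1 * r ^ k.+1) <= B.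
Proof.
move=> t0 [r0 rR] ext; have := ext (RtoC r); rewrite Cmod_R Rabs_pos_eq // => /(_ rR) H.
exists (fst (G (RtoC r))); apply: gseries_bounded => //.
have pr k : @pow_n C_AbsRing (RtoC r) k = RtoC (r ^ k).
  elim: k => [|k IH] //=; rewrite IH /mult /= -RtoC_mult //.
pose u k := @scal C_AbsRing C_NormedModule (@pow_n C_AbsRing (RtoC r) k) (RtoC (gcoef t k)).
have uE k : fst (u k) = gcoef t k * r ^ k by rewrite /u pr /scal /= /mult /=; ring.
have ps n : fst (sum_n u n) = sum_n (fun k => gcoef t k * r ^ k) n.
  elim: n => [|n IH]; first by rewrite !sum_O uE.
  by rewrite !sum_Sn -IH -uE.
apply: (is_lim_seq_ext _ _ _ ps).
move=> P [e He]; apply: (H (fun z => P (fst z))).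
by exists e => z [hz _]; apply: He.
Qed.

Lemma gn1_lim kappa r :
  0 <= r -> Rbar_lt r (CV_radius (gcoef kappa)) ->
  is_lim_seq (fun n => \sum_(0 <= k < n) (kappa k.+1 * r ^ k.+1)) (gn kappa 1 r).
Proof.
move=> r0 rR; have rR' : Rbar_lt (Rabs r) (CV_radius (gcoef kappa)) by rewrite Rabs_pos_eq.
have /is_pseries_R H := is_pseries_derive _ _ rR'.
apply/is_lim_seq_incr_1.
apply: (is_lim_seq_ext (fun n => r * sum_n (fun k => PS_derive (gcoef kappa) k * r ^ k) n)) => [n|].
  rewrite sum_n_big big_distrr /=; apply: eq_big_nat => k _.
  rewrite /PS_derive -/(INR k.+1) /gcoef; have := INR_S_gt0 k => ?.
  by field; lra.
have -> : Finite (gn kappa 1 r) = Rbar_mult r (Derive (PSeries (gcoef kappa)) r).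
  by rewrite /gn pow_1.
exact: is_lim_seq_scal_l.
Qed.

Lemma psum_le_gn1 kappa r n :
  (forall k, 0 <= kappa k.+1) -> 0 <= r -> Rbar_lt r (CV_radius (gcoef kappa)) ->
  \sum_(0 <= k < n) (kappa k.+1 * r ^ k.+1) <= gn kappa 1 r.
Proof.
move=> ka0 r0 rR; apply: (is_lim_seq_incr_compare _ _ (gn1_lim r0 rR)) => m.
rewrite big_nat_recr //=; have := Rmult_le_pos _ _ (ka0 m) (pow_le _ m.+1 r0).
rewrite /=; lra.
Qed.

Lemma gn1_le kappa r x :
  (forall k, 0 <= kappa k.+1) -> 0 <= r <= x -> Rbar_lt x (CV_radius (gcoef kappa)) ->
  gn kappa 1 r <= gn kappa 1 x.
Proof.
move=> ka0 [r0 rx] xR; have rR : Rbar_lt r (CV_radius (gcoef kappa)).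
  by apply: (Rbar_le_lt_trans _ x).
have x0 : 0 <= x by lra.
apply: (is_lim_seq_le _ _ (Finite _) (Finite _) _ (gn1_lim r0 rR) (gn1_lim x0 xR)) => n.
apply: Rsum_le => k _; apply: Rmult_le_compat_l => //; exact: pow_incr.
Qed.

(** Below the radius a partial sum is at most [gn kappa 1 r], which is monotone and hence at most
    its left limit [l]. A finite sum is continuous, so the bound persists at [rs]. *)
Lemma psum_le1_at_radius kappa rs l n :
  (forall k, 0 <= kappa k.+1) -> 0 < rs -> CV_radius (gcoef kappa) = Finite rs ->
  gnR kappa (Finite rs) 1 l -> Rbar_le l 1 ->
  \sum_(0 <= k < n) (kappa k.+1 * rs ^ k.+1) <= 1.
Proof.
move=> ka0 rs0 Rad lim l1.
have below r : 0 <= r < rs -> \sum_(0 <= k < n) (kappa k.+1 * r ^ k.+1) <= 1.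
  move=> [r0 rrs]; apply: Rle_trans (psum_le_gn1 n ka0 r0 _) _; first by rewrite Rad.
  suff : Rbar_le (gn kappa 1 r) l by move=> H; exact: (Rbar_le_trans _ _ _ H l1).
  apply: (filterlim_le (F := at_left rs) (fun=> gn kappa 1 r) (gn kappa 1)) lim.
    have e0 : 0 < rs - r by lra.
    exists (mkposreal _ e0) => x /Rabs_lt_between' /= [x1 _] x2.
    apply: gn1_le => //; [lra | by rewrite Rad].
  exact: filterlim_const.
set s := \sum_(0 <= k < n) _.
have s0 : 0 <= s by apply: Rsum_ge0 => k _; apply: Rmult_le_pos => //; apply: pow_le; lra.
apply: le_epsilon => e e0.
have pd : 0 < s * INR n + 1 by have := Rmult_le_pos _ _ s0 (pos_INR n); lra.
(* Chosen so that [s * (1 - n d) <= 1] gives [s <= 1 + e]; the added 1 keeps the divisor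
   positive. *)
pose d := e / (s * INR n + 1).
have d0 : 0 < d by exact: Rdiv_lt_0_compat.
have rd : 0 <= rs * exp (- d) < rs.
  have p := exp_pos (- d); have : exp (- d) < 1 by rewrite -exp_0; apply: exp_increasing; lra.
  split; nra.
have H : s * exp (- (INR n * d)) <= 1.
  apply: Rle_trans (below _ rd); rewrite big_distrl /=; apply: Rsum_le => k /andP[_ kn].
  rewrite Rmult_assoc; apply: Rmult_le_compat_l => //.
  change (rs ^ k.+1 * exp (- (INR n * d)) <= (rs * exp (- d)) ^ k.+1).
  rewrite Rpow_mult_distr exp_pow_INR; apply: Rmult_le_compat_l; first by apply: pow_le; lra.
  apply: exp_le; have : INR k.+1 <= INR n by apply: le_INR; apply/leP.
  nra.
have H2 := exp_ineq1_le (- (INR n * d)).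
have H3 : s * (1 - INR n * d) <= 1.
  by apply: Rle_trans H; apply: Rmult_le_compat_l; lra.
have H4 : d * (s * INR n + 1) = e by rewrite /d; field; lra.
nra.
Qed.

(** Otherwise the coefficients would be bounded against powers of [rs * exp e], and the radius of
    convergence would exceed [rs]. *)
Lemma exists_heavy_length kappa rs e :
  (forall k, 0 <= kappa k.+1) -> 0 < rs -> CV_radius (gcoef kappa) = Finite rs -> 0 < e ->
  exists L, (0 < L)%N /\ exp (- e * INR L) <= kappa L * rs ^ L.
Proof.
move=> ka0 rs0 Rad e0; apply: Classical_Prop.NNPP => no.
have [ub _] := CV_radius_bounded (gcoef kappa); rewrite Rad in ub.
have /= : Rbar_le (rs * exp e) rs.
  apply: ub; exists 1 => -[|n]; first by rewrite /= Rmult_0_l Rabs_R0; lra.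
  have pn := INR_S_gt0 n; have pr : 0 < rs * exp e by apply: Rmult_lt_0_compat => //; exact: exp_pos.
  rewrite Rabs_pos_eq; last by apply: Rmult_le_pos; [exact: gcoef_ge0 | apply: pow_le; lra].
  rewrite Rpow_mult_distr exp_pow_INR /gcoef.
  have H : kappa n.+1 * rs ^ n.+1 <= exp (- e * INR n.+1).
    by apply: Rnot_lt_le => L; apply: no; exists n.+1; split => //; lra.
  have H2 := Rmult_le_compat_r _ _ _ (Rlt_le _ _ (exp_pos (INR n.+1 * e))) H.
  rewrite -exp_plus (_ : - e * INR n.+1 + INR n.+1 * e = 0) ?exp_0 in H2; last by ring.
  have -> : kappa n.+1 / INR n.+1 * (rs ^ n.+1 * exp (INR n.+1 * e)) =
    kappa n.+1 * rs ^ n.+1 * exp (INR n.+1 * e) / INR n.+1 by field; lra.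
  apply/Rle_div_l => //; have : 1 <= INR n.+1 by rewrite S_INR; have := pos_INR n; lra.
  lra.
have : 1 < exp e by rewrite -exp_0; apply: exp_increasing.
nra.
Qed.

(** * Reduction of the six hypotheses to the core estimate *)

Lemma gseries_theta_bounded theta kappa :
  (forall k, 0 <= theta k.+1) ->
  hyp_Sub theta kappa \/ hyp_Sup1 theta kappa \/ hyp_Sup0 theta kappa \/
  hyp_Crit1 theta kappa \/ hyp_Crit2 theta kappa \/ hyp_Crit3 theta kappa ->
  Rbar_lt 0 (CV_radius (gcoef kappa)) /\
  forall r, 0 <= r -> Rbar_lt r (CV_radius (gcoef kappa)) ->
    exists B, forall n, \sum_(0 <= k < n) (theta k.+1 / INR k.+1 * r ^ k.+1) <= B.
Proof.
move=> th0.
have same : CV_radius (gcoef theta) = CV_radius (gcoef kappa) ->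
    forall r, 0 <= r -> Rbar_lt r (CV_radius (gcoef kappa)) ->
    exists B, forall n, \sum_(0 <= k < n) (theta k.+1 / INR k.+1 * r ^ k.+1) <= B.
  by move=> E r r0 rR; apply: gseries_bounded_CV_radius => //; rewrite E.
case=> [[E [R0 _]]|]; first by split => //; exact: same.
case=> [[Rr [Ek [Et [R0 _]]]]|]; first by split; [rewrite Ek | apply: same; rewrite Ek].
case=> [[Rr [Ek [R0 [eta [phi [Gt [Gk [e [_ [_ [_ [_ [ext _]]]]]]]]]]]]]|].
  rewrite Ek; split=> // r r0 rR; exact: (gseries_bounded_extends th0 (conj r0 rR) ext).
case=> [[E [R0 _]]|]; first by split => //; exact: same.
by case=> [[Rr [Ek [Et [R0 _]]]]|[Rr [Ek [Et [R0 _]]]]];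
  (split; [rewrite Ek | apply: same; rewrite Ek]).
Qed.

Theorem theorem4p3 (theta kappa : nat -> R)
  (Htheta : forall j : nat, (1 <= j)%N -> 0 <= theta j)
  (Hkappa : forall j : nat, (1 <= j)%N -> 0 <= kappa j)
  (Hnonar : non_arithmetic kappa)
  (Hk2 : exists j : nat, (2 <= j)%N /\ 0 < kappa j)
  (Hyp : hyp_Sub theta kappa \/ hyp_Sup1 theta kappa \/ hyp_Sup0 theta kappa \/
         hyp_Crit1 theta kappa \/ hyp_Crit2 theta kappa \/ hyp_Crit3 theta kappa)
  (rs : R) (Hrs : is_rstar kappa rs) (K : nat) :
  conv_in_prob theta kappa K
    (1 - sumR (seq.iota 1 K) (fun j => kappa j * rs ^ j)).
Proof.
have th0 k : 0 <= theta k.+1 by exact: Htheta.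
have ka0 k : 0 <= kappa k.+1 by exact: Hkappa.
have [R0 HB] := gseries_theta_bounded th0 Hyp.
pose rho k := kappa k * rs ^ k.
have -> : sumR (seq.iota 1 K) (fun j => kappa j * rs ^ j) = \sum_(0 <= k < K) rho k.+1.
  by rewrite sumR_big -(big_add1 _ _ 0 K.+1 xpredT rho) /index_iota subSS subn0.
have [rs0 rsR rho1 alt] : [/\ 0 < rs, Rbar_le rs (CV_radius (gcoef kappa)),
    forall n, \sum_(0 <= k < n) rho k.+1 <= 1 &
    (forall e, 0 < e -> exists n, 1 - e <= \sum_(0 <= k < n) rho k.+1) \/
    (forall e, 0 < e -> exists L, (0 < L)%N /\ exp (- e * INR L) <= rho L)].
  (* This covers both ways in which [rs] can be the radius: a left limit below 1 or equal to 1.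
     Filling then relies on heavy lengths. *)
  have at_radius l : Finite rs = CV_radius (gcoef kappa) ->
      gnR kappa (CV_radius (gcoef kappa)) 1 l -> Rbar_le l 1 ->
      [/\ 0 < rs, Rbar_le rs (CV_radius (gcoef kappa)),
        forall n, \sum_(0 <= k < n) rho k.+1 <= 1 &
        (forall e, 0 < e -> exists n, 1 - e <= \sum_(0 <= k < n) rho k.+1) \/
        (forall e, 0 < e -> exists L, (0 < L)%N /\ exp (- e * INR L) <= rho L)].
    move=> E lim l1; have rs0 : 0 < rs by rewrite -E in R0.
    rewrite -E in lim *; split => //=; first exact: Rle_refl.
      by move=> n; apply: psum_le1_at_radius lim l1.
    by right=> e; apply: exists_heavy_length.
  case: Hrs => l [lim [[l1 [rs0 [rsR [inside edge]]]]|[l1 E]]]; last first.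
    by apply: at_radius E lim _; exact: Rbar_lt_le.
  have [rsR'|E] := Rbar_le_lt_or_eq_dec _ _ rsR; last first.
    by apply: (at_radius l) => //; rewrite (edge E); exact: Rbar_le_refl.
  have E := inside rsR'; have rs0' : 0 <= rs by lra.
  (* Strictly inside the disc the partial sums of [rho] increase to [gn kappa 1 rs = 1], so few
     points remain to be filled. *)
  split => // [n|]; first by rewrite -E; exact: psum_le_gn1.
  left=> e e0; have := gn1_lim rs0' rsR'; rewrite E => /is_lim_seq_spec /(_ (mkposreal e e0)).
  case=> n /(_ n (Nat.le_refl n)) /= /Rabs_lt_between' [H _].
  by exists n; exact: Rlt_le.
apply: conv_in_prob_core => //.
  move=> r [r0 rrs]; apply: HB; first lra.
  exact: (Rbar_lt_le_trans _ rs).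
move=> d d1; apply: Classical_Prop.NNPP => no; apply: Hnonar; exists d; split=> // j j1 kj.
apply/negPn/negP => dj; apply: no; exists j; split => //.
apply: Rmult_lt_0_compat; last exact: pow_lt.
by have := Hkappa j j1; case=> // E; case: kj.
Qed.
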